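(* Let $R=[a,b]\times[c,d]$, $m,n\in\mathbb{N}$ and $2\le\beta\le3$. Let $f:R\to\mathbb{R}$ be an $(m,n)$-convex function such that $f(a,y)=f(x,c)=0$ for all $x\in[a,b]$, $y\in[c,d]$. Then for every $\epsilon>0$ there exists an $(m,n)$-convex function $g:R\to\mathbb{R}$ such that $D^{(m,n)}g\in\mathcal{S}_\beta$ and $\|f-g\|_\infty<\epsilon$.
   Context: $a<b$ and $c<d$ are real numbers. $D^{(k,l)}f:=\dfrac{\partial^{k+l}f}{\partial x^k\,\partial y^l}$, and $\mathcal{C}^{m,n}(R)$ is the set of functions $f:R\to\mathbb{R}$ such that $D^{(k,l)}f$ is continuous on $R$ for all $0\le k\le m$, $0\le l\le n$. A function $f\in\mathcal{C}^{m,n}(R)$ is called $(m,n)$-convex if $D^{(m,n)}f(\boldsymbol{x})\ge0$ for all $\boldsymbol{x}\in R$. $\mathcal{S}_\beta:=\{g\in\mathcal{C}(R):\dim(Gr(g))=\beta\}$, where $\mathcal{C}(R)$ is the space of continuous real functions on $R$, $Gr(g)\subset\mathbb{R}^3$ is the graph of $g$, and $\dim$ is any one (fixed) of the Hausdorff, box or packing dimensions. $\|\cdot\|_\infty$ is the supremum norm on $R$. *)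

(* Defs.v *)
From HB Require Import structures.
From mathcomp Require Import all_boot all_order all_algebra.
From mathcomp Require Import all_classical all_reals all_analysis.

Set Implicit Arguments.
Unset Strict Implicit.
Unset Printing Implicit Defensive.

Import Order.TTheory GRing.Theory Num.Theory.
Import numFieldNormedType.Exports.

Local Open Scope classical_set_scope.
Local Open Scope ring_scope.

(* Functions on the rectangle are total functions R * R -> R; every notion
   below depends only on their values on [rect]. *)
Section Rectangle.
Context {R : realType}.
Variables (a b c d : R).
Implicit Types (F : R * R -> R) (p : R * R).

Definition rect : set (R * R) := `[a, b]%classic `*` `[c, d]%classic.

Definition supnorm F : \bar R := ereal_sup [set `|F p|%:E | p in rect].

Definition diffquot (u : R -> R) (x t : R) : R := (u t - u x) / (t - x).

(* Derivative of u at x relative to I: when I is a compact interval this is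
   the usual derivative at interior points and the one-sided derivative at
   the endpoints. *)
Definition derivable_in (I : set R) (u : R -> R) (x : R) : Prop :=
  cvg (diffquot u x @ within I x^').

Definition deriv_in (I : set R) (u : R -> R) (x : R) : R :=
  lim (diffquot u x @ within I x^').

Definition x_derivable F p : Prop :=
  derivable_in `[a, b]%classic (fun x => F (x, p.2)) p.1.

Definition y_derivable F p : Prop :=
  derivable_in `[c, d]%classic (fun y => F (p.1, y)) p.2.

Definition Dx F p : R := deriv_in `[a, b]%classic (fun x => F (x, p.2)) p.1.

Definition Dy F p : R := deriv_in `[c, d]%classic (fun y => F (p.1, y)) p.2.

Definition D (k l : nat) F : R * R -> R := iter k Dx (iter l Dy F).

(* [D k l F] is a total function; this says that the partial derivative it
   denotes, taken l times in y and then k times in x, exists on [rect]. *)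
Definition D_exists (k l : nat) F : Prop :=
  (forall j p, (j < l)%N -> rect p -> y_derivable (D 0 j F) p) /\
  (forall i p, (i < k)%N -> rect p -> x_derivable (D i l F) p).

Definition Cmn (m n : nat) F : Prop :=
  forall k l, (k <= m)%N -> (l <= n)%N ->
    D_exists k l F /\ {within rect, continuous (D k l F)}.

Definition mn_convex (m n : nat) F : Prop :=
  Cmn m n F /\ forall p, rect p -> 0 <= D m n F p.

(* The graph over [rect], as a subset of R^3. *)
Definition graph F : set 'rV[R]_3 :=
  [set \row_(i < 3) [:: p.1; p.2; F p]`_i | p in rect].

End Rectangle.

Section FractalDimensions.
Context {R : realType} {N : nat}.
Implicit Types (E U : set 'rV[R]_N) (s r delta : R).

(* The library norm on 'rV[R]_N is the maximum norm. *)
Definition eucl_dist (u v : 'rV[R]_N) : R :=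
  Num.sqrt (\sum_(i < N) (u ord0 i - v ord0 i) ^+ 2).

Definition eucl_cball (x : 'rV[R]_N) r : set 'rV[R]_N :=
  [set y | eucl_dist x y <= r].

Definition eucl_diam U : \bar R :=
  ereal_sup (0%E |` [set (eucl_dist p.1 p.2)%:E | p in U `*` U]).

(* Hausdorff measure and dimension. Countable families are indexed by an
   arbitrary set I of natural numbers. *)
Definition is_cover delta E (I : set nat) (U : nat -> set 'rV[R]_N) : Prop :=
  (forall i, I i -> (eucl_diam (U i) <= delta%:E)%E) /\
  E `<=` \bigcup_(i in I) U i.

Definition hausdorff_pre s delta E : \bar R :=
  ereal_inf [set \esum_(i in IU.1) poweR (eucl_diam (IU.2 i)) s
            | IU in [set IU | is_cover delta E IU.1 IU.2]].

(* The limit as delta -> 0+, which is a supremum by monotonicity. *)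
Definition hausdorff_measure s E : \bar R :=
  ereal_sup [set hausdorff_pre s delta E | delta in [set e : R | 0 < e]].

Definition hausdorff_dim E : \bar R :=
  ereal_inf [set s%:E | s in [set s : R | 0 <= s /\ hausdorff_measure s E = 0%E]].

(* Packing measure and dimension. *)
Definition is_packing delta E (I : set nat) (x : nat -> 'rV[R]_N)
    (r : nat -> R) : Prop :=
  (forall i, I i -> E (x i) /\ 0 < r i <= delta) /\
  trivIset I (fun i => eucl_cball (x i) (r i)).

(* A ball of radius r has diameter 2 r. *)
Definition packing_pre s delta E : \bar R :=
  ereal_sup [set \esum_(i in Ixr.1.1) ((2 * Ixr.2 i) `^ s)%:E
            | Ixr in [set Ixr | is_packing delta E Ixr.1.1 Ixr.1.2 Ixr.2]].

(* The limit as delta -> 0+, which is an infimum by monotonicity. *)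
Definition packing_premeasure s E : \bar R :=
  ereal_inf [set packing_pre s delta E | delta in [set e : R | 0 < e]].

Definition packing_measure s E : \bar R :=
  ereal_inf [set \esum_(i in [set: nat]) packing_premeasure s (U i)
            | U in [set U : nat -> set 'rV[R]_N | E `<=` \bigcup_i U i]].

Definition packing_dim E : \bar R :=
  ereal_inf [set s%:E | s in [set s : R | 0 <= s /\ packing_measure s E = 0%E]].

(* Least number of sets of diameter at most delta that cover E. *)
Definition box_count delta E : \bar R :=
  ereal_inf [set k%:R%:E | k in
    [set k : nat | exists U : nat -> set 'rV[R]_N, is_cover delta E `I_k U]].

(* The lower and upper box dimensions of E both equal beta. *)
Definition has_box_dim E (beta : R) : Prop :=
  (lne (box_count delta E) * ((- ln delta)^-1)%:E)%E
    @[delta --> (0 : R)^'+] --> beta%:E.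

End FractalDimensions.

Inductive dimension_kind := Hausdorff | Box | Packing.

Definition has_dim {R : realType} {N : nat} (dim : dimension_kind)
    (E : set 'rV[R]_N) (beta : R) : Prop :=
  match dim with
  | Hausdorff => hausdorff_dim E = beta%:E
  | Box => has_box_dim E beta
  | Packing => packing_dim E = beta%:E
  end.

Definition S_beta {R : realType} (dim : dimension_kind) (a b c d beta : R) :
    set (R * R -> R) :=
  [set g | {within rect a b c d, continuous g} /\
           has_dim dim (graph a b c d g) beta].

(* Main.v *)
(* Let phi = D^(m,n) f. If h >= 0 is continuous and uniformly close to phi, then
   adding to f the n-fold integral in y of the m-fold integral in x of h - phi
   gives a function g uniformly close to f with D^(m,n) g = h. So it is enough to
   find such an h whose graph has dimension beta.

   Take h(x, y) = P(x, y) + k (w((x - a) / (b - a)) + 1) with k > 0 small and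
   P >= 0 a Lipschitz function close to phi. The graph of w is refined from three
   columns to the next three: a "stacked" step puts the copies along a diagonal
   and divides the height by 3, a "zigzag" step (up, down, up) keeps the height.
   Stacked steps are performed with frequency theta = 3 - beta. As w maps the
   Lebesgue measure of every triadic column to the uniform measure of its range,
   the set of x' with |x' - x| <= r and |w x' - w x| <= r has measure
   r^(2 - theta + o(1)), uniformly in x. Lifting the Lebesgue measure of the
   rectangle to the graph of h thus gives mass r^(beta + o(1)) to every ball of
   radius r centered on the graph, and such a two-sided uniform estimate
   determines the Hausdorff, box and packing dimensions at once. *)

Require Import Defs.
From mathcomp Require Import all_boot all_order all_algebra.
From mathcomp Require Import all_classical all_reals all_analysis.
From mathcomp Require Import measurable_realfun.
From mathcomp Require Import ring lra zify.

Set Implicit Arguments.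
Unset Strict Implicit.
Unset Printing Implicit Defensive.

Import Order.TTheory GRing.Theory Num.Theory.
Import numFieldNormedType.Exports.

Local Open Scope classical_set_scope.
Local Open Scope ring_scope.

(** * Sets carrying a measure of prescribed local dimension *)

(** The exponent 2 - theta has a simple origin. A column of width 3^-j has a range of length 3^-n,
    where n, about theta * j, counts the stacked steps among the first j. Values being uniformly
    distributed in that range, those within r = 3^-j of a given one occupy a fraction of about r *
    3^n of the column, hence mass r * 3^-j * 3^n = r^(2 - theta); the second variable adds a factor
    r. Equidistribution holds in every column, so the estimate holds at every point of the graph and
    not just almost everywhere.

    A merely continuous phi could have a graph of any dimension and spoil this count. Adding a
    Lipschitz P is only a bi-Lipschitz shear of R^3, which changes masses of balls by constants;
    taking P below phi and nonnegative keeps h nonnegative.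

    The delicate endpoint is beta = 3: with zigzag steps alone the refinements do not converge to a
    continuous function, so a sublinear number of stacked steps is kept. The price is an arbitrarily
    small loss in the exponent of the upper mass bound. *)

Section EuclDist.
Context {R : realType} {N : nat}.
Implicit Types (x y z : 'rV[R]_N).

Lemma eucl_dist_ge0 x y : 0 <= eucl_dist x y.
Proof. exact: sqrtr_ge0. Qed.

Lemma eucl_distC x y : eucl_dist x y = eucl_dist y x.
Proof.
by rewrite /eucl_dist; congr Num.sqrt; apply: eq_bigr => i _; rewrite -sqrrN opprB.
Qed.

(* From (a + b)^2 <= 2 a^2 + 2 b^2; Cauchy-Schwarz is not needed for this
   special case of the triangle inequality. *)
Lemma eucl_dist_tri2 x y z (r : R) :
  eucl_dist x y <= r -> eucl_dist y z <= r -> eucl_dist x z <= 2 * r.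
Proof.
move=> xy yz; have r0 : 0 <= r := le_trans (eucl_dist_ge0 x y) xy.
have sq u v : eucl_dist u v <= r -> \sum_(i < N) (u ord0 i - v ord0 i) ^+ 2 <= r ^+ 2.
  move=> uv; rewrite -[leLHS]sqr_sqrtr; last by apply: sumr_ge0 => i _; exact: sqr_ge0.
  by rewrite ler_sqr ?nnegrE ?sqrtr_ge0.
rewrite /eucl_dist -[leRHS]ger0_norm ?mulr_ge0// -sqrtr_sqr ler_wsqrtr//.
apply: (@le_trans _ _ (2 * (\sum_(i < N) (x ord0 i - y ord0 i) ^+ 2 +
    \sum_(i < N) (y ord0 i - z ord0 i) ^+ 2))).
  rewrite -big_split/= mulr_sumr ler_sum// => i _.
  have : 0 <= ((x ord0 i - y ord0 i) - (y ord0 i - z ord0 i)) ^+ 2 by exact: sqr_ge0.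
  by nra.
have := sq _ _ xy; have := sq _ _ yz; nra.
Qed.

Lemma eucl_diam_le (U : set 'rV[R]_N) r : 0 <= r ->
  (forall x y, U x -> U y -> eucl_dist x y <= r) -> (eucl_diam U <= r%:E)%E.
Proof.
move=> r0 Ur; apply: ge_ereal_sup => _ [->|[[x y] [/= Ux Uy] <-]].
  by rewrite lee_fin.
by rewrite lee_fin; exact: Ur.
Qed.

Lemma eucl_diam_ge0 (U : set 'rV[R]_N) : (0 <= eucl_diam U)%E.
Proof. by apply: ereal_sup_ubound; left. Qed.

Lemma eucl_dist_le_diam (U : set 'rV[R]_N) x y : U x -> U y ->
  ((eucl_dist x y)%:E <= eucl_diam U)%E.
Proof. by move=> Ux Uy; apply: ereal_sup_ubound; right; exists (x, y). Qed.

Lemma eucl_diam_cball x r : 0 <= r ->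
  (eucl_diam (eucl_cball x r) <= (2 * r)%:E)%E.
Proof.
move=> r0; apply: eucl_diam_le => [|y z]; first by rewrite mulr_ge0.
by rewrite /eucl_cball/= [eucl_dist x y]eucl_distC; exact: eucl_dist_tri2.
Qed.

Definition dist_separated (r : R) (U : set 'rV[R]_N) k (x : nat -> 'rV[R]_N) :=
  (forall i, (i < k)%N -> U (x i)) /\
  (forall i j, (i < k)%N -> (j < k)%N -> i != j -> r < eucl_dist (x i) (x j)).

Lemma separated_packing (r : R) (U : set 'rV[R]_N) k (x : nat -> 'rV[R]_N) :
  0 < r -> dist_separated (2 * r) U k x ->
  is_packing r U `I_k x (fun=> r).
Proof.
move=> r0 [xU xsep]; split=> [i /= ik|]; first by split; [exact: xU|rewrite r0/=].
apply/trivIsetP => i j /= ik jk ij; rewrite -subset0 => z [/= xiz xjz].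
have := xsep _ _ ik jk ij; rewrite ltNge => /negP; apply.
by apply: (@eucl_dist_tri2 _ z) => //; rewrite eucl_distC.
Qed.

(** A family of maximal size is a net, since a point far from all its members could be appended; the
    bound [M] makes a maximal size exist. *)
Lemma max_separated (r : R) (U : set 'rV[R]_N) (M : nat) :
  (forall k (x : nat -> _), dist_separated r U k x -> (k <= M)%N) ->
  exists k (x : nat -> _),
  dist_separated r U k x /\ forall y, U y -> exists2 i, (i < k)%N & eucl_dist (x i) y <= r.
Proof.
move=> bd; pose P k := `[< exists x : nat -> _, dist_separated r U k x >].
have exP : exists k, P k by exists 0%N; apply/asboolP; exists (fun=> 0); split.
have ubP k : P k -> (k <= M)%N by move=> /asboolP[x]; exact: bd.
case: (ex_maxnP exP ubP) => k /asboolP[x sx] kmax.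
exists k, x; split=> // y Uy; apply: contrapT => nex.
have far i : (i < k)%N -> r < eucl_dist (x i) y.
  by move=> ik; rewrite ltNge; apply/negP => xiy; apply: nex; exists i.
suff /kmax : P k.+1 by rewrite ltnn.
case: sx => xU xsep.
apply/asboolP; exists (fun i => if (i < k)%N then x i else y); split.
  by move=> i _; case: ifPn => // ik; exact: xU.
move=> i j; rewrite !ltnS => ik jk ij.
case: ltnP => ik'; case: ltnP => jk'.
- exact: xsep.
- exact: far.
- by rewrite eucl_distC; exact: far.
- by move: ij; rewrite (@anti_leq i k) ?ik ?ik'// (@anti_leq j k) ?jk ?jk'// eqxx.
Qed.

End EuclDist.

Lemma esum_ord (R : realType) k (a : nat -> \bar R) :
  (forall i, (i < k)%N -> (0 <= a i)%E) ->
  \esum_(i in `I_k) a i = (\sum_(i < k) a i)%E.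
Proof.
move=> a0; rewrite fsbig_ord esum_fset//.
by move=> i; rewrite inE; exact: a0.
Qed.

Lemma esumZl (R : realType) (I : set nat) (c : R) (a : nat -> \bar R) :
  0 <= c -> (forall i, (0 <= a i)%E) ->
  \esum_(i in I) (c%:E * a i)%E = (c%:E * \esum_(i in I) a i)%E.
Proof.
move=> c0 a0; have <- : [set x | x \in I] = I by apply/seteqP; split=> i /=; rewrite inE.
by rewrite -!nneseries_esum ?nneseriesZl// => i _; rewrite mule_ge0.
Qed.

Lemma powRV (R : realType) (x s : R) : 0 <= x -> x^-1 `^ s = (x `^ s)^-1.
Proof. by move=> x0; rewrite -(powR_inv1 x0) powRAC powR_inv1 ?powR_ge0. Qed.

(** * From uniform mass estimates to the three dimensions *)

Section RegularSets.
Context {R : realType} {N : nat} (d : measure_display) (T : measurableType d).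
Variables (mu : {measure set T -> \bar R}) (X : set T) (G : T -> 'rV[R]_N).
(* [B q r] is comparable, up to the factor [K], with the preimage by [G] of the
   ball of radius [r] centered at [G q]; the preimages need not be measurable. *)
Variables (B : T -> R -> set T) (K beta : R).
Hypothesis mX : measurable X.
Hypothesis X_fin : (mu X < +oo)%E.
Hypothesis X_gt0 : (0 < mu X)%E.
Hypothesis mB : forall q r, measurable (B q r).
Hypothesis B_sub : forall q r, B q r `<=` X.
Hypothesis K_ge1 : 1 <= K.
Hypothesis B_in : forall q q' (r : R), X q -> X q' -> 0 <= r ->
  eucl_dist (G q) (G q') <= r -> B q (K * r) q'.
Hypothesis B_out : forall q q' r, X q -> B q r q' ->
  eucl_dist (G q) (G q') <= K * r.
Hypothesis beta_gt0 : 0 < beta.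
(** The constants may depend on [s], which absorbs factors r^o(1), but not on [q]. Radius 0 is
    included because sets of diameter 0 occur in covers. *)
Hypothesis B_le : forall s : R, 0 <= s < beta -> exists2 C : R, 0 < C &
  forall q (r : R), X q -> 0 <= r <= 1 -> (mu (B q r) <= (C * r `^ s)%:E)%E.
Hypothesis B_ge : forall s : R, beta < s -> exists2 C : R, 0 < C &
  forall q (r : R), X q -> 0 < r <= 1 -> ((C * r `^ s)%:E <= mu (B q r))%E.

Local Notation E := (G @` X).
Local Notation outer := (mu_ext mu).
Let preG (U : set 'rV[R]_N) : set T := [set q | X q /\ U (G q)].

Let K_gt0 : 0 < K. Proof. exact: lt_le_trans K_ge1. Qed.

Let betaS : beta < beta + 1. Proof. by rewrite ltrDl. Qed.

Let M := fine (mu X).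

Let M_gt0 : 0 < M.
Proof. by rewrite /M fine_gt0// X_gt0 X_fin. Qed.

Let MX : mu X = M%:E.
Proof. by rewrite /M fineK// ge0_fin_numE. Qed.

Let outer_le A Y : measurable Y -> A `<=` Y -> (outer A <= mu Y)%E.
Proof.
by move=> mY AY; rewrite -(measurable_mu_extE mu)//; exact: le_mu_ext.
Qed.

Let outer_ge0 A : (0 <= outer A)%E.
Proof. by apply: mu_ext_ge0 => Y; exact: measure_ge0. Qed.

Let preGE : preG E = X.
Proof. by apply/seteqP; split=> [q []//|q Xq]; split=> //; exists q. Qed.

Let outer_cover (V : set 'rV[R]_N) (I : set nat) (U : nat -> set 'rV[R]_N) :
  V `&` E `<=` \bigcup_(i in I) U i ->
  (outer (preG V) <= \esum_(i in I) outer (preG (U i)))%E.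
Proof.
move=> VU; rewrite esum_mkcond -nneseries_esumT; last first.
  by move=> i; case: ifP => // _; exact: outer_ge0.
pose A i := if i \in I then preG (U i) else set0.
apply: (@le_trans _ _ (\sum_(i <oo) outer (A i))%E).
  apply: le_trans (@mu_ext_sigma_subadditive _ _ _ mu _ A); last exact: measure_ge0.
  apply: le_mu_ext => q [Xq VGq].
  have [|i Ii UGq] := VU (G q); first by split=> //; exists q.
  by exists i => //; rewrite /A mem_set.
apply: lee_nneseries => [i _ _|i _]; first exact: outer_ge0.
by rewrite /A; case: ifP => // _; rewrite mu_ext0//; exact: measure_ge0.
Qed.

(** Input of the mass distribution principle: a set of diameter at most [r] lies in the ball of
    radius [r] around any of its points on the graph. Taking [K^-1] for [rho] keeps [K * r] in the
    range of [B_le]. *)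
Let mass_upper (s : R) : 0 <= s < beta -> exists C : R, exists rho : R, [/\ 0 < C, 0 < rho &
  forall U r, 0 <= r <= rho -> (forall x y, U x -> U y -> eucl_dist x y <= r) ->
  (outer (preG U) <= (C * r `^ s)%:E)%E].
Proof.
move=> sbeta; have [C C0 CB] := B_le sbeta.
exists (C * K `^ s), K^-1; split; rewrite ?mulr_gt0 ?invr_gt0 ?powR_gt0// => U r.
move=> /andP[r0 rK] Ur; have [U0|/set0P[q [Xq Uq]]] := eqVneq (preG U) set0.
  rewrite U0 mu_ext0//.
  by rewrite lee_fin !mulr_ge0// ?powR_ge0// ltW.
apply: (@le_trans _ _ (mu (B q (K * r)))).
  apply: outer_le => // q' [Xq' Uq']; apply: B_in => //; exact: Ur.
apply: le_trans (CB _ _ Xq _) _.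
  by rewrite mulr_ge0 ?(ltW K_gt0)//= mulrC -ler_pdivlMr// div1r.
by rewrite lee_fin powRM// ?(ltW K_gt0)// mulrA.
Qed.

(** Disjoint balls have disjoint preimages, which contain the sets [B (q i) (r i / K)]; the masses
    of these, bounded below by [B_ge], add up to at most that of [X]. *)
Let packing_upper (s : R) : beta < s -> exists2 C : R, 0 < C &
  forall I x r, is_packing 1 E I x r -> (\esum_(i in I) (r i `^ s)%:E <= C%:E)%E.
Proof.
move=> sbeta; have [C C0 CB] := B_ge sbeta.
exists (M * K `^ s / C); first by rewrite divr_gt0// mulr_gt0// powR_gt0.
move=> I x r [Ix trI].
have /choice[q qP] : forall i, exists q, I i -> X q /\ G q = x i.
  move=> i; have [Ii|nIi] := pselect (I i); last by exists point.
  by have [[q Xq Gq] _] := Ix _ Ii; exists q.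
have r01 i : I i -> 0 < r i / K <= 1.
  move=> Ii; have [_ /andP[r0 r1]] := Ix _ Ii; rewrite divr_gt0//=.
  by rewrite ler_pdivrMr// mul1r (le_trans r1).
have disj : trivIset I (fun i => B (q i) (r i / K)).
  apply/trivIsetP => i j Ii Ij ij; rewrite -subset0 => z [zi zj].
  have /trivIsetP/(_ _ _ Ii Ij ij) := trI; rewrite -subset0 => /(_ (G z)); apply; split.
    have [Xq <-] := qP _ Ii; rewrite /eucl_cball/=.
    by have := B_out Xq zi; rewrite mulrCA mulfV ?mulr1// gt_eqF.
  have [Xq <-] := qP _ Ij; rewrite /eucl_cball/=.
  by have := B_out Xq zj; rewrite mulrCA mulfV ?mulr1// gt_eqF.
have : (\esum_(i in I) mu (B (q i) (r i / K)) <= M%:E)%E.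
  rewrite -MX; apply: le_trans (_ : mu (\bigcup_(i in I) B (q i) (r i / K)) <= _)%E.
    rewrite measure_bigcup// nneseries_esum//.
    by rewrite (_ : [set x | x \in I] = I)//; apply/seteqP; split=> i /=; rewrite inE.
  apply: le_measure; rewrite ?inE//; first exact: bigcup_measurable.
  by apply: bigcup_sub => i _; exact: B_sub.
have le1 : (\esum_(i in I) (C / K `^ s * r i `^ s)%:E <=
    \esum_(i in I) mu (B (q i) (r i / K)))%E.
  apply: le_esum => i Ii; have [Xq _] := qP _ Ii.
  apply: le_trans (CB _ _ Xq (r01 _ Ii)); rewrite lee_fin.
  have [_ /andP[r0 _]] := Ix _ Ii.
  by rewrite powRM ?invr_ge0 ?(ltW r0) ?(ltW K_gt0)// powRV ?(ltW K_gt0)// mulrA mulrAC.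
move=> /(le_trans le1).
under eq_esum do rewrite EFinM.
rewrite esumZl; last 2 first.
- by rewrite divr_ge0 ?powR_ge0// ltW.
- by move=> i; rewrite lee_fin powR_ge0.
rewrite -lee_pdivlMl ?divr_gt0 ?powR_gt0//.
by rewrite -EFinM invf_div mulrC mulrA.
Qed.

(** A maximal 2r-separated set gives a packing by balls of radius r, which controls its size, and a
    cover by balls of radius 2r. *)
Let net_upper (s : R) : beta < s -> exists2 C : R, 0 < C &
  forall (U : set 'rV[R]_N) r, 0 < r <= 1 ->
  exists k, exists x : nat -> 'rV[R]_N,
  [/\ dist_separated (2 * r) (U `&` E) k x, k%:R * r `^ s <= C &
      forall y, (U `&` E) y -> exists2 i, (i < k)%N & eucl_dist (x i) y <= 2 * r].
Proof.
move=> sbeta; have [C C0 CP] := packing_upper sbeta.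
exists C => // U r /andP[r0 r1].
have bd k (x : nat -> 'rV[R]_N) : dist_separated (2 * r) (U `&` E) k x -> k%:R * r `^ s <= C.
  move=> sx; have [xU xr] := separated_packing r0 sx.
  have /CP : is_packing 1 E `I_k x (fun=> r).
    by split=> // i /xU[[]]; rewrite r0 r1.
  rewrite esum_ord; last by move=> i _; rewrite lee_fin powR_ge0.
  by rewrite sumEFin lee_fin sumr_const card_ord mulr_natl.
have [|k [x [sx xnet]]] := @max_separated _ _ (2 * r) (U `&` E) (Num.bound (C / r `^ s)).
  move=> k x /bd; rewrite -ler_pdivlMr ?powR_gt0// => kC.
  rewrite -(ler_nat R) (le_trans kC)// ltW// archi_boundP//.
  by rewrite divr_ge0 ?powR_ge0// ltW.
by exists k, x; split=> //; exact: bd sx.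
Qed.

(** Mass distribution principle: a cover by sets of diameter at most [rho] must carry the whole mass
    [M], so its sum of diam^s is at least M / C. *)
Let hausdorff_lower (s : R) : 0 <= s < beta -> hausdorff_measure s E != 0%E.
Proof.
move=> sbeta; have [C [rho [C0 rho0 mass]]] := mass_upper sbeta.
apply/eqP => H0.
have : (hausdorff_pre s rho E <= 0)%E.
  by rewrite -H0; apply: ereal_sup_ubound; exists rho.
apply/negP; rewrite -ltNge.
apply: (@lt_le_trans _ _ (C^-1 * M)%:E); first by rewrite lte_fin mulr_gt0 ?invr_gt0.
apply: le_ereal_inf_tmp => _ [[I U] /= [Udiam EU] <-].
rewrite EFinM lee_pdivrMl//.
rewrite -MX -(measurable_mu_extE mu mX) -{1}preGE.
apply: (le_trans (outer_cover (I := I) (U := U) _)).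
  by rewrite setIid.
apply: (@le_trans _ _ (\esum_(i in I) (C%:E * poweR (eucl_diam (U i)) s))%E).
  apply: le_esum => i Ii; have := eucl_diam_ge0 (U i); have := Udiam _ Ii.
  case E : (eucl_diam (U i)) => [r| |]//; rewrite !lee_fin => rrho r0.
  rewrite poweR_EFin -EFinM; apply: mass; first by rewrite r0.
  by move=> x y Ux Uy; rewrite -lee_fin -E; exact: eucl_dist_le_diam.
by rewrite esumZl// ?(ltW C0)// => i; exact: poweR_ge0.
Qed.

Let hausdorff_upper (s : R) : beta < s -> hausdorff_measure s E = 0%E.
Proof.
move=> sbeta; apply/eqP; rewrite eq_le; apply/andP; split; last first.
  apply: (@le_trans _ _ (hausdorff_pre s 1 E)); last first.
    by apply: ereal_sup_ubound; exists 1 => /=.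
  apply: le_ereal_inf_tmp => _ [[I U] _ <-]; apply: esum_ge0 => i _; exact: poweR_ge0.
apply: ge_ereal_sup => _ [delta /= delta0 <-]; apply/lee_addgt0Pr => e e0.
rewrite add0e.
(* At the intermediate exponent [t], nets have at most C * r^-t points, so the sum of diam^s over
   the cover is O(r^(s - t)). *)
pose t := (beta + s) / 2; have tbeta : beta < t by rewrite /t; lra.
have ts : 0 < s - t by rewrite /t; lra.
have [C C0 CP] := net_upper tbeta.
pose c := C * 4 `^ s; have c0 : 0 < c by rewrite mulr_gt0// powR_gt0.
near (0 : R)^'+ => r.
have r0 : 0 < r by [].
have r1 : r <= 1 by near: r; exact: nbhs_right_le.
have rdelta : 4 * r <= delta.
  rewrite mulrC -ler_pdivlMr//; near: r; apply: nbhs_right_le; exact: divr_gt0.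
have re : c * r `^ (s - t) <= e.
  rewrite mulrC -ler_pdivlMr//; near: r.
  have : 0 < e / c by rewrite divr_gt0.
  have := powR_cvg0 ts => /cvgrPdist_le h /h; apply: filterS => z.
  by rewrite sub0r normrN ger0_norm// powR_ge0.
have [|k [x [_ kr xnet]]] := CP setT r; first by rewrite r0.
have diam i : (eucl_diam (eucl_cball (x i) (2 * r)) <= (4 * r)%:E)%E.
  apply: le_trans (eucl_diam_cball _ _) _; first by rewrite mulr_ge0// ltW.
  by rewrite lee_fin mulrA -natrM.
apply: (@le_trans _ _ (\esum_(i in `I_k) poweR (eucl_diam (eucl_cball (x i) (2 * r))) s)).
  apply: ereal_inf_lbound; exists (`I_k, fun i => eucl_cball (x i) (2 * r)) => //=.
  split=> [i _|y Ey]; first by apply: le_trans (diam i) _; rewrite lee_fin.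
  by have [|i ik xiy] := xnet y; [split|exists i].
rewrite esum_ord; last by move=> i _; exact: poweR_ge0.
apply: (@le_trans _ _ (\sum_(i < k) ((4 * r) `^ s)%:E)%E).
  apply: lee_sum => i _; rewrite -poweR_EFin.
  apply: gt0_ler_poweR; rewrite ?in_itv/= ?leey ?andbT.
  - by rewrite (le_trans (ltW beta_gt0))// ltW.
  - exact: eucl_diam_ge0.
  - by rewrite lee_fin mulr_ge0// ltW.
  - exact: diam.
rewrite sumEFin lee_fin sumr_const card_ord -[leLHS]mulr_natl (le_trans _ re)//.
have -> : (4 * r) `^ s = 4 `^ s * (r `^ t * r `^ (s - t)).
  by rewrite powRM ?(ltW r0)// -powRD ?subrKC// (gt_eqF r0) implybT.
rewrite mulrCA !mulrA -[4 `^ s * _ * _]mulrA [4 `^ s * _]mulrC /c.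
by rewrite !ler_wpM2r ?powR_ge0.
Unshelve. all: by end_near. Qed.

Let box_lower (s : R) : 0 <= s < beta -> exists C : R, exists rho : R,
  [/\ 0 < C, 0 < rho & forall delta, 0 < delta <= rho ->
  ((C * delta `^ (- s))%:E <= box_count delta E)%E].
Proof.
move=> sbeta; have [C [rho [C0 rho0 mass]]] := mass_upper sbeta.
exists (M / C), rho; split; rewrite ?divr_gt0// => delta /andP[delta0 deltarho].
apply: le_ereal_inf_tmp => _ [k /= [U [Udiam EU]] <-]; rewrite lee_fin.
rewrite powRN ler_pdivrMr ?powR_gt0// ler_pdivrMr// -lee_fin -MX.
rewrite -(measurable_mu_extE mu mX) -{1}preGE.
apply: (le_trans (outer_cover (I := `I_k) (U := U) _)); first by rewrite setIid.
rewrite esum_ord//; apply: (@le_trans _ _ (\sum_(i < k) (C * delta `^ s)%:E)%E).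
  apply: lee_sum => i _; apply: mass; first by rewrite ltW.
  move=> x y Ux Uy; rewrite -lee_fin; apply: le_trans (Udiam i (ltn_ord i)).
  exact: eucl_dist_le_diam.
by rewrite sumEFin lee_fin sumr_const card_ord -[leLHS]mulr_natl [C * _]mulrC mulrA.
Qed.

Let box_upper (s : R) : beta < s -> exists C : R, exists rho : R,
  [/\ 0 < C, 0 < rho & forall delta, 0 < delta <= rho ->
  (box_count delta E <= (C * delta `^ (- s))%:E)%E].
Proof.
move=> sbeta; have [C C0 CP] := net_upper sbeta.
(* Balls of radius 2 * (delta / 4) have diameter at most [delta], and delta <= 4 puts the net scale
   delta / 4 in the range of [net_upper]. *)
exists (C * 4 `^ s), 4; split; rewrite ?mulr_gt0 ?powR_gt0// => delta /andP[delta0 delta4].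
have [|k [x [_ kr xnet]]] := CP setT (delta / 4).
  by rewrite divr_gt0//= ler_pdivrMr// mul1r.
apply: (@le_trans _ _ k%:R%:E).
  apply: ereal_inf_lbound; exists k => //=.
  exists (fun i => eucl_cball (x i) (2 * (delta / 4))); split=> [i _|y Ey].
    apply: le_trans (eucl_diam_cball _ _) _; first by rewrite mulr_ge0// divr_ge0// ltW.
    by rewrite lee_fin; lra.
  by have [|i ik xiy] := xnet y; [split|exists i].
have d4 : 0 < delta / 4 by rewrite divr_gt0.
rewrite lee_fin powRN; move: kr; rewrite -ler_pdivlMr ?powR_gt0// => /le_trans; apply.
by rewrite powRM ?invr_ge0 ?(ltW delta0)// powRV// invfM invrK mulrAC mulrA.
Qed.

(** Packing measure splits [E] into arbitrary pieces, so the premeasure of every [U] is compared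
    with the outer mass of its preimage, which is countably subadditive: around a maximal
    2r-separated set, the balls of radius r form a packing while those of radius 2r cover the part
    of [U] on the graph. *)
Let packing_lower (s : R) : 0 <= s < beta -> packing_measure s E != 0%E.
Proof.
move=> sbeta; have [C [rho [C0 rho0 mass]]] := mass_upper sbeta.
(* Any exponent above [beta] serves here, as only the existence of finite nets is wanted. *)
have [D _ net] := net_upper betaS.
pose c := (C * 2 `^ s)^-1; have c0 : 0 < c by rewrite invr_gt0 mulr_gt0// powR_gt0.
have pre_ge U : (c%:E * outer (preG U) <= packing_premeasure s U)%E.
  apply: le_ereal_inf_tmp => _ [delta /= delta0 <-].
  pose r := Order.min delta (Order.min 1 (rho / 4)).
  have r0 : 0 < r by rewrite /r !lt_min delta0 ltr01 divr_gt0.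
  have rdelta : r <= delta by rewrite /r ge_min lexx.
  have r1 : r <= 1 by rewrite /r !ge_min lexx orbT.
  have rrho : 4 * r <= rho.
    by rewrite mulrC -ler_pdivlMr// /r !ge_min lexx !orbT.
  have [|k [x [sx _ xnet]]] := net U r; first by rewrite r0.
  apply: (@le_trans _ _ (\esum_(i in `I_k) ((2 * r) `^ s)%:E)); last first.
    apply: ereal_sup_ubound; exists (`I_k, x, fun=> r) => //=.
    have [xU xr] := separated_packing r0 sx; split=> // i /xU[[Ux _] _].
    by rewrite r0 rdelta.
  rewrite lee_pdivrMl//.
  apply: (le_trans (outer_cover (I := `I_k) (U := fun i => eucl_cball (x i) (2 * r)) _)).
    by move=> y /xnet[i ik xiy]; exists i.
  rewrite !esum_ord//; last by move=> i _; rewrite lee_fin powR_ge0.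
  apply: (@le_trans _ _ (\sum_(i < k) (C * (4 * r) `^ s)%:E)%E).
    apply: lee_sum => i _; apply: mass; first by rewrite mulr_ge0// ltW.
    move=> y z; rewrite /eucl_cball/= [eucl_dist _ y]eucl_distC => xy xz.
    by rewrite (_ : 4 = 2 * 2 :> R) -?mulrA; [exact: eucl_dist_tri2 xy xz|ring].
  rewrite !sumEFin -EFinM lee_fin !sumr_const card_ord -mulrnAr.
  have -> : (4 * r) `^ s = 2 `^ s * (2 * r) `^ s.
    by rewrite -powRM ?mulr_ge0// ?(ltW r0)// mulrA -natrM.
    by rewrite -mulrnAr mulrA.
  by rewrite mulr_gt0// powR_gt0.
apply/eqP => P0.
have : (packing_measure s E <= 0)%E by rewrite P0.
apply/negP; rewrite -ltNge.
apply: (@lt_le_trans _ _ (c * M)%:E); first by rewrite lte_fin mulr_gt0.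
apply: le_ereal_inf_tmp => _ [U EU <-].
apply: (@le_trans _ _ (\esum_(i in [set: nat]) (c%:E * outer (preG (U i)))%E)); last first.
  by apply: le_esum => i _; exact: pre_ge.
rewrite esumZl ?(ltW c0)// EFinM lee_pmul2l ?lte_fin// -MX.
rewrite -(measurable_mu_extE mu mX) -{1}preGE.
by apply: outer_cover; rewrite setIid.
Qed.

Let packing_upper0 (s : R) : beta < s -> packing_measure s E = 0%E.
Proof.
move=> sbeta.
have pre_ge0 U : (0 <= packing_premeasure s U)%E.
  apply: le_ereal_inf_tmp => _ [delta /= delta0 <-].
  apply: ereal_sup_ubound; exists (set0, fun=> 0, fun=> 0); last by rewrite esum_set0.
  by split=> // i j [].
apply/eqP; rewrite eq_le; apply/andP; split; last first.
  by apply: le_ereal_inf_tmp => _ [U _ <-]; apply: esum_ge0.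
suff pre0 : packing_premeasure s E = 0%E.
  apply: (@le_trans _ _ (\esum_(i in [set: nat]) packing_premeasure s E)).
    by apply: ereal_inf_lbound; exists (fun=> E) => //= y Ey; exists 0%N.
  by rewrite esum1.
apply/eqP; rewrite eq_le pre_ge0 andbT; apply/lee_addgt0Pr => e e0.
rewrite add0e.
(* For radii at most [delta], r^s <= delta^(s - t) * r^t, and the sums of r^t over packings are
   bounded. *)
pose t := (beta + s) / 2; have tbeta : beta < t by rewrite /t; lra.
have ts : 0 < s - t by rewrite /t; lra.
have [C C0 CP] := packing_upper tbeta.
pose c := C * 2 `^ s; have c0 : 0 < c by rewrite mulr_gt0// powR_gt0.
near (0 : R)^'+ => delta.
have delta0 : 0 < delta by [].
have delta1 : delta <= 1 by near: delta; exact: nbhs_right_le.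
have deltae : c * delta `^ (s - t) <= e.
  rewrite mulrC -ler_pdivlMr//; near: delta.
  have : 0 < e / c by rewrite divr_gt0.
  have := powR_cvg0 ts => /cvgrPdist_le h /h; apply: filterS => z.
  by rewrite sub0r normrN ger0_norm// powR_ge0.
apply: (@le_trans _ _ (packing_pre s delta E)).
  by apply: ereal_inf_lbound; exists delta.
apply: ge_ereal_sup => _ [[[I x] r] /= [xE xr] <-].
have /CP h : is_packing 1 E I x r.
  by split=> // i /xE[Ex /andP[r0 rd]]; split=> //; rewrite r0 (le_trans rd).
apply: (@le_trans _ _ (\esum_(i in I) ((2 `^ s * delta `^ (s - t))%:E * (r i `^ t)%:E)%E)).
  apply: le_esum => i /xE[_ /andP[r0 rd]]; rewrite lee_fin powRM ?(ltW r0)//.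
  rewrite -mulrA ler_wpM2l ?powR_ge0//.
  have -> : r i `^ s = r i `^ (s - t) * r i `^ t.
    by rewrite -powRD ?subrK// (gt_eqF r0) implybT.
  by rewrite ler_wpM2r ?powR_ge0// ge0_ler_powR ?nnegrE// ltW.
rewrite esumZl ?mulr_ge0 ?powR_ge0//; last by move=> i; rewrite lee_fin powR_ge0.
apply: (@le_trans _ _ ((2 `^ s * delta `^ (s - t))%:E * C%:E)%E).
  by rewrite lee_wpmul2l// lee_fin mulr_ge0 ?powR_ge0.
by rewrite -EFinM lee_fin (le_trans _ deltae)// /c mulrC mulrA.
Unshelve. all: by end_near. Qed.

Let dim_inf (m : R -> \bar R) : (forall s, 0 <= s < beta -> m s != 0%E) ->
  (forall s, beta < s -> m s = 0%E) ->
  ereal_inf [set s%:E | s in [set s : R | 0 <= s /\ m s = 0%E]] = beta%:E.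
Proof.
move=> mlt mgt; apply/eqP; rewrite eq_le; apply/andP; split.
  apply/lee_addgt0Pr => e e0; apply: ereal_inf_lbound; exists (beta + e) => //.
  by split; [rewrite ltW// addr_gt0|rewrite mgt// ltrDl].
apply: le_ereal_inf_tmp => _ [s [s0 ms] <-]; rewrite lee_fin leNgt.
by apply/negP => sbeta; have := mlt s; rewrite s0 sbeta ms eqxx => /(_ isT).
Qed.

Let box_dim : has_box_dim E beta.
Proof.
pose l (delta : R) : R := ln (fine (box_count delta E)) / (- ln delta).
have lE : \forall delta \near (0 : R)^'+,
    (lne (box_count delta E) * ((- ln delta)^-1)%:E)%E = (l delta)%:E.
  have [C [rho [C0 rho0 Cle]]] := box_upper betaS.
  have s0 : 0 <= (0 : R) < beta by rewrite lexx.
  have [c [rho' [c0 rho'0 cle]]] := box_lower s0.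
  near=> delta.
  have delta0 : 0 < delta by [].
  have deltarho : delta <= rho by near: delta; exact: nbhs_right_le.
  have deltarho' : delta <= rho' by near: delta; exact: nbhs_right_le.
  have := Cle delta; rewrite delta0 deltarho => /(_ isT).
  have := cle delta; rewrite delta0 deltarho' => /(_ isT).
  rewrite /l; case: (box_count delta E) => [n| |]//; rewrite !lee_fin => cn _.
  by rewrite lne_EFin// (lt_le_trans _ cn)// mulr_gt0// powR_gt0.
suff lF : l delta @[delta --> (0 : R)^'+] --> beta.
  apply: cvg_EFin; first by apply: filterS lE => delta ->.
  apply: cvg_trans lF; apply: near_eq_cvg.
  by apply: filterS lE => delta /= ->.
apply/cvgrPdist_le => e e0.
(* [box_lower] asks for a nonnegative exponent. *)
pose s := Order.max 0 (beta - e / 2).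
have s_beta : 0 <= s < beta by rewrite /s le_max lexx/= gt_max beta_gt0/=; lra.
have se : beta - e / 2 <= s by rewrite /s le_max lexx orbT.
have t_beta : beta < beta + e / 2 by lra.
have [C [rho [C0 rho0 Cle]]] := box_upper t_beta.
have [c [rho' [c0 rho'0 cle]]] := box_lower s_beta.
(* Once [- ln delta] reaches [L], both |ln C| and |ln c| are at most e / 2 times it. *)
pose L := 1 + (`|ln C| + `|ln c|) * 2 / e.
have L0 : 0 < L by rewrite ltr_pwDl// divr_ge0 ?mulr_ge0 ?addr_ge0// ltW.
near=> delta.
have delta0 : 0 < delta by [].
have deltarho : delta <= rho by near: delta; exact: nbhs_right_le.
have deltarho' : delta <= rho' by near: delta; exact: nbhs_right_le.
have := Cle delta; rewrite delta0 deltarho => /(_ isT).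
have := cle delta; rewrite delta0 deltarho' => /(_ isT).
rewrite /l; case: (box_count delta E) => [n| |]//; rewrite !lee_fin/= => cn nC.
pose lam := - ln delta.
have lamL : L <= lam.
  rewrite /lam lerNr -[leRHS]expRK ler_ln ?posrE ?expR_gt0//.
  by near: delta; apply: nbhs_right_le; exact: expR_gt0.
have lam0 : 0 < lam by rewrite (lt_le_trans L0).
have : e / 2 * L <= e / 2 * lam by rewrite ler_wpM2l// ltW// divr_gt0.
have -> : e / 2 * L = e / 2 + (`|ln C| + `|ln c|) by rewrite /L; field; rewrite gt_eqF.
move=> eL; have lnC := ler_norm (ln C); have lnc := ler_norm (- ln c).
have := normr_ge0 (ln C); have := normr_ge0 (ln c); rewrite normrN in lnc.
move=> nc nC0; have {lnC} lnC : ln C <= e / 2 * lam by lra.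
have {lnc} lnc : - (e / 2 * lam) <= ln c by lra.
have n0 : 0 < n by rewrite (lt_le_trans _ cn)// mulr_gt0// powR_gt0.
have nC' : ln n <= ln C + (beta + e / 2) * lam.
  apply: le_trans (_ : ln (C * delta `^ (- (beta + e / 2))) <= _).
    by rewrite ler_ln ?posrE// mulr_gt0// powR_gt0.
  by rewrite lnM ?posrE ?powR_gt0// ln_powR mulNr mulrN.
have cn' : ln c + s * lam <= ln n.
  apply: le_trans (_ : _ <= ln (c * delta `^ (- s))) _.
    by rewrite lnM ?posrE ?powR_gt0// ln_powR mulNr mulrN.
  by rewrite ler_ln ?posrE// mulr_gt0// powR_gt0.
rewrite -/lam ler_distlC ler_pdivlMr// ler_pdivrMr//; apply/andP; split; nra.
Unshelve. all: by end_near. Qed.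

Theorem regular_has_dim dim : has_dim dim E beta.
Proof.
case: dim => /=.
- exact: dim_inf hausdorff_lower hausdorff_upper.
- exact: box_dim.
- exact: dim_inf packing_lower packing_upper0.
Qed.

End RegularSets.

(** * A rough continuous function of one variable *)

Section ZigzagCells.
Context {R : realType}.
Implicit Types (x y z u v : R) (s t : seq bool).
Local Notation lambda := (@lebesgue_measure R).

Definition clamp lo hi x : R := Order.max lo (Order.min hi x).

Lemma clamp_id lo hi x : lo <= x <= hi -> clamp lo hi x = x.
Proof. by move=> /andP[lx xh]; rewrite /clamp (min_idPr xh) (max_idPr lx). Qed.

Lemma clamp_itv lo hi x : lo <= hi -> lo <= clamp lo hi x <= hi.
Proof. by move=> lh; rewrite /clamp le_max lexx ge_max lh ge_min lexx. Qed.

Lemma clamp_le lo hi x : x <= lo -> clamp lo hi x = lo.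
Proof. by move=> xl; apply/max_idPl; rewrite ge_min xl orbT. Qed.

Lemma clamp_ge lo hi x : lo <= hi -> hi <= x -> clamp lo hi x = hi.
Proof. by move=> lh hx; rewrite /clamp (min_idPl hx) (max_idPr lh). Qed.

Lemma clamp_mono lo hi x y : x <= y -> clamp lo hi x <= clamp lo hi y.
Proof.
rewrite /clamp /Order.max /Order.min => xy.
by do ![case: ifPn; rewrite -?leNgt]; lra.
Qed.

Lemma clamp_lip lo hi x y : x <= y -> clamp lo hi y - clamp lo hi x <= y - x.
Proof.
rewrite /clamp /Order.max /Order.min => xy.
by do ![case: ifPn; rewrite -?leNgt]; lra.
Qed.

Lemma clamp_dist lo hi x y : `|clamp lo hi x - clamp lo hi y| <= `|x - y|.
Proof.
wlog xy : x y / x <= y => [H|].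
  by have [/H//|/ltW/H] := leP x y; rewrite distrC [leRHS]distrC.
rewrite distrC [leRHS]distrC !ger0_norm ?subr_ge0 ?clamp_mono//.
exact: clamp_lip.
Qed.

(* The graph of [zigzag (b :: t)] consists of three affine copies of the graph
   of [zigzag t], of width 1/3: if b, they have height 1/3 and are stacked
   along the diagonal; otherwise they have height 1 and the middle one is
   reflected.  Both cases are given by one formula on the line, as all these
   functions are 0 before 0 and 1 after 1. *)
Fixpoint zigzag t x : R :=
  if t is b :: t' then
    let w0 := zigzag t' (3 * x) in
    let w1 := zigzag t' (3 * x - 1) in
    let w2 := zigzag t' (3 * x - 2) in
    if b then (w0 + w1 + w2) / 3 else w0 - w1 + w2
  else clamp 0 1 x.

Lemma zigzag_le0 t x : x <= 0 -> zigzag t x = 0.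
Proof.
elim: t x => [|b t IH] x x0 /=; first exact: clamp_le.
by rewrite !IH ?if_same ?addr0 ?subr0 ?mul0r//; [case: b|lra..].
Qed.

Lemma zigzag_ge1 t x : 1 <= x -> zigzag t x = 1.
Proof.
elim: t x => [|b t IH] x x1 /=; first exact: clamp_ge.
by rewrite !IH; [case: b; lra|lra..].
Qed.

(** How the outermost step [b] places the values of its [i]-th copy. *)
Definition branch (b : bool) (i : nat) z : R :=
  if b then (i%:R + z) / 3 else if i == 1%N then 1 - z else z.

Lemma zigzag_branch b t i x : (i < 3)%N -> i%:R <= 3 * x <= i.+1%:R ->
  zigzag (b :: t) x = branch b i (zigzag t (3 * x - i%:R)).
Proof.
rewrite /branch; move: i => [|[|[|//]]] _ /andP[x1 x2] /=; rewrite ?subr0.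
- by rewrite !(@zigzag_le0 t (3 * x - _)); [case: b; lra|lra..].
- rewrite (@zigzag_ge1 t (3 * x)); last lra.
  by rewrite (@zigzag_le0 t (3 * x - 2)); [case: b; lra|lra].
- rewrite (@zigzag_ge1 t (3 * x)); last lra.
  by rewrite (@zigzag_ge1 t (3 * x - 1)); [case: b; lra|lra].
Qed.

Lemma third_cell x : 0 <= x < 1 ->
  exists2 i, (i < 3)%N & i%:R <= 3 * x < i.+1%:R.
Proof.
move=> /andP[x0 x1]; have [xl|xl] := ltP (3 * x) 1.
  by exists 0%N => //; lra.
have [xr|xr] := ltP (3 * x) 2; first by exists 1%N => //; lra.
by exists 2%N => //; lra.
Qed.

Lemma zigzag01 t x : 0 <= zigzag t x <= 1.
Proof.
elim: t x => [|b t IH] x; first exact: clamp_itv.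
have [x0|x0] := leP x 0; first by rewrite zigzag_le0// lexx ler01.
have [x1|x1] := leP 1 x; first by rewrite zigzag_ge1// lexx ler01.
have [|i i3 xi] := @third_cell x; first by rewrite (ltW x0).
rewrite (zigzag_branch _ _ i3); last by case/andP: xi => -> /ltW.
have := IH (3 * x - i%:R); move: i i3 {xi} => [|[|[|//]]] _; rewrite /branch; case: b => /=; lra.
Qed.

(** A step combines three copies compressed threefold, hence the crude factor 9; only continuity is
    drawn from it. *)
Lemma zigzag_lip t x y : `|zigzag t x - zigzag t y| <= 9 ^+ size t * `|x - y|.
Proof.
elim: t x y => [|b t IH] x y /=; first by rewrite mul1r clamp_dist.
have [c cE] : exists c, c = 9 ^+ size t * `|3 * (x - y)| by eexists.
have h k : `|zigzag t (3 * x - k) - zigzag t (3 * y - k)| <= c.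
  by rewrite (le_trans (IH _ _))// cE (_ : 3 * x - k - (3 * y - k) = 3 * (x - y))//; ring.
have := h 0; have := h 1; have := h 2; rewrite !subr0.
rewrite exprS -mulrA mulrCA (_ : 9 * `|x - y| = 3 * `|3 * (x - y)|); last first.
  by rewrite normrM ger0_norm//; ring.
rewrite mulrCA -cE !ler_distlC; case: b; lra.
Qed.

(** The two tails take values in [0, 1]; each stacked step divides their difference by 3, while a
    zigzag step preserves it. *)
Lemma zigzag_prefix t s1 s2 x :
  `|zigzag (t ++ s1) x - zigzag (t ++ s2) x| <= 3 ^- count id t.
Proof.
elim: t x => [|b t IH] x.
  by rewrite expr0 invr1 /=; have := zigzag01 s1 x; have := zigzag01 s2 x; rewrite ler_distlC; lra.
have pos (k : nat) : 0 <= (3 : R) ^- k by rewrite invr_ge0 exprn_ge0.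
rewrite !cat_cons.
have [x0|x0] := leP x 0; first by rewrite !zigzag_le0// subrr normr0.
have [x1|x1] := leP 1 x; first by rewrite !zigzag_ge1// subrr normr0.
have [|i i3 xi] := @third_cell x; first by rewrite (ltW x0).
have xi' : i%:R <= 3 * x <= i.+1%:R by case/andP: xi => -> /ltW.
rewrite !(zigzag_branch _ _ i3 xi').
have := IH (3 * x - i%:R); rewrite !ler_distlC /branch => /andP[h1 h2].
case: b => /=; last by rewrite add0n; case: ifP => _; lra.
rewrite add1n exprS invfM; lra.
Qed.

Lemma cellP x : 0 <= x < 1 -> forall j, exists2 i : nat, (i < 3 ^ j)%N &
  i%:R <= 3 ^+ j * x < i.+1%:R.
Proof.
move=> /andP[x0 x1] j; have p0 : 0 < (3 : R) ^+ j by rewrite exprn_gt0.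
have y0 : 0 <= 3 ^+ j * x by rewrite mulr_ge0// ltW.
exists (Num.truncn (3 ^+ j * x)); last exact: truncn_itv.
have xle : (Num.truncn (3 ^+ j * x))%:R <= 3 ^+ j * x by rewrite truncn_le.
rewrite -(ltr_nat R) (le_lt_trans xle)// natrX.
by rewrite -[ltRHS]mulr1 ltr_pM2l.
Qed.

Lemma zigzag_cell t i : (i < 3 ^ size t)%N -> exists e sg : R,
  (sg = 1 \/ sg = -1) /\ forall s x, i%:R <= 3 ^+ size t * x <= i.+1%:R ->
  zigzag (t ++ s) x = e + sg * (3 ^- count id t * zigzag s (3 ^+ size t * x - i%:R)).
Proof.
elim: t i => [|b t IH] i /=.
  rewrite expn0 ltnS leqn0 => /eqP->; exists 0, 1; split; first by left.
  by move=> s x _; rewrite !expr0 invr1 !mul1r add0r subr0.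
set m := (3 ^ size t)%N => ilt; have m0 : (0 < m)%N by rewrite expn_gt0.
have d3 : (i %/ m < 3)%N by rewrite ltn_divLR// -expnS.
have [|e [sg [sgE IHe]]] := IH (i %% m)%N; first by rewrite ltn_mod.
pose dd : R := (i %/ m)%:R.
have iE : i%:R = m%:R * dd + (i %% m)%:R :> R.
  by rewrite {1}(divn_eq i m) natrD natrM mulrC.
have im : (i %% m)%:R + 1 <= m%:R :> R by rewrite natr1 ler_nat ltn_mod.
have im0 : 0 <= (i %% m)%:R :> R by [].
have mE : m%:R = 3 ^+ size t :> R by rewrite /m natrX.
have step s x : i%:R <= 3 ^+ (size t).+1 * x <= i.+1%:R ->
    zigzag (b :: t ++ s) x = branch b (i %/ m)
      (e + sg * (3 ^- count id t * zigzag s (3 ^+ (size t).+1 * x - i%:R))).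
  rewrite exprS -mE -[i.+1%:R]natr1 => /andP[x1 x2].
  have mR : 0 < m%:R :> R by rewrite ltr0n.
  rewrite (zigzag_branch _ _ d3); last first.
    by rewrite -natr1 -/dd; apply/andP; split; rewrite -(ler_pM2l mR); nra.
  rewrite IHe -/dd; last by rewrite -mE -natr1; nra.
  by rewrite -mE (_ : _ * (3 * x - dd) - _ = 3 * m%:R * x - i%:R)// iE; ring.
case: b step => step.
  exists ((dd + e) / 3), sg; split=> // s x xi.
  by rewrite -[LHS]/(zigzag (true :: t ++ s) x) (step _ _ xi) /branch add1n (exprS _ (count id t)) invfM -/dd; ring.
rewrite add0n; have [d1|d1] := eqVneq (i %/ m)%N 1%N.
  exists (1 - e), (- sg); split; first by case: sgE => ->; rewrite ?opprK; [right|left].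
  by move=> s x xi; rewrite -[LHS]/(zigzag (false :: t ++ s) x) (step _ _ xi) /branch d1 eqxx; ring.
exists e, sg; split=> // s x xi.
by rewrite -[LHS]/(zigzag (false :: t ++ s) x) (step _ _ xi) /branch (negbTE d1).
Qed.

End ZigzagCells.

(** * Equidistribution of the values *)

Section ZigzagMeasure.
Context {R : realType}.
Implicit Types (x y z u v : R) (s t : seq bool).
Local Notation lambda := (@lebesgue_measure R).

Lemma lipschitz_continuous (g : R -> R) (k : R) :
  (forall x y, `|g x - g y| <= k * `|x - y|) -> continuous g.
Proof.
move=> glip x; apply/cvgrPdist_le => e e0.
have k1 : 0 < `|k| + 1 by rewrite ltr_wpDl.
have : \forall y \near x, `|x - y| < e / (`|k| + 1).
  by apply: nbhsx_ballx; rewrite divr_gt0.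
apply: filterS => y; rewrite ltr_pdivlMr// => xy.
apply: le_trans (glip _ _) _; apply: le_trans (ltW xy).
rewrite mulrC ler_wpM2l//; have := ler_norm k; lra.
Qed.

Lemma measurable_zigzag t : measurable_fun setT (zigzag t : R -> R).
Proof.
apply: continuous_measurable_fun; apply: lipschitz_continuous; exact: zigzag_lip.
Qed.

Lemma lebesgue_measure_affine (k c : R) (A : set R) : 0 < k -> measurable A ->
  lambda ((fun x => k * x - c) @^-1` A) = ((k^-1)%:E * lambda A)%E.
Proof.
move=> k0 mA; pose phi (x : R) : measurableTypeR R := k * x - c.
have mphi : measurable_fun setT phi.
  apply: measurable_funB => //; exact: measurable_funM.
(* The pushforward is a measure only for a measurable map, so that [nu] takes
   the proof [mphi] as an argument. *)
pose nu : {measure set (measurableTypeR R) -> \bar R} :=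
  mscale (NngNum (ltW k0)) (pushforward lambda phi).
have -> : lambda A = nu mphi A.
  apply: (@lebesgue_measure_unique R (nu mphi)) => //= _ [[a b]] _ <-.
  rewrite /mscale/= /pushforward.
  have -> : phi @^-1` `]a, b] = `](a + c) / k, (b + c) / k]%classic.
    apply/seteqP; split=> x /=; rewrite !in_itv/= /phi ltr_pdivrMr// ler_pdivlMr//;
      rewrite ltrBrDr lerBlDr [k * x]mulrC//.
  rewrite !lebesgue_measure_itv/= !lte_fin ltr_pM2r ?invr_gt0// ltrD2r.
  case: ifP => _; last by rewrite mule0.
  by rewrite -!EFinD -EFinM; congr EFin; field; rewrite gt_eqF.
by rewrite /mscale/= /pushforward muleA -EFinM mulVf ?gt_eqF// mul1e.
Qed.

(** Half-open at 1, so that the three thirds are disjoint in the induction on [t]. *)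
Definition slice t u v : set R := [set x | 0 <= x < 1 /\ u <= zigzag t x <= v].

Lemma measurable_slice t u v : measurable (slice t u v).
Proof.
have -> : slice t u v = `[0, 1[%classic `&` zigzag t @^-1` `[u, v]%classic.
  by apply/seteqP; split=> x /=; rewrite /slice/= !in_itv.
apply: measurableI => //; rewrite -[X in measurable X]setTI.
exact: measurable_zigzag.
Qed.

(** The set splits into three slices of [zigzag t] compressed threefold, so that equidistribution is
    inherited from the branches. *)
Lemma slice_measure t u v : u <= v ->
  lambda (slice t u v) = (clamp 0 1 v - clamp 0 1 u)%:E.
Proof.
elim: t u v => [|b t IH] u v uv.
  have cuv : clamp 0 1 u <= clamp 0 1 v by exact: clamp_mono.
  have itvE p q : lambda [set` Interval (BSide p (clamp 0 1 u)) (BSide q (clamp 0 1 v))]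
      = (clamp 0 1 v - clamp 0 1 u)%:E.
    rewrite lebesgue_measure_itv/= lte_fin lt_neqAle cuv andbT.
    by have [->|] := eqVneq; rewrite ?subrr.
  apply/eqP; rewrite eq_le -{1}(itvE true false) -(itvE false true).
  apply/andP; split; apply: le_measure; rewrite ?inE//; try exact: measurable_slice.
    move=> x [x01]; have xE : clamp 0 1 x = x.
      by apply: clamp_id; case/andP: x01 => -> /ltW.
    by rewrite /= xE in_itv/= => /andP[ux xv]; rewrite -xE !clamp_mono.
  have [/andP[cu0 _] /andP[_ cv1]] := (@clamp_itv R 0 1 u ler01, @clamp_itv R 0 1 v ler01).
  move=> x /=; rewrite in_itv/= /slice/= => /andP[ux xv].
  have xE : clamp 0 1 x = x by apply: clamp_id; lra.
  split; first lra.
  rewrite xE; apply/andP; split; rewrite leNgt; apply/negP => /ltW/(clamp_mono 0 1); rewrite xE; lra.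
(* [lo i, hi i] is the preimage of [u, v] under [branch b i]. *)
pose lo i : R := if b then 3 * u - i%:R else if i == 1%N then 1 - v else u.
pose hi i : R := if b then 3 * v - i%:R else if i == 1%N then 1 - u else v.
pose P i := (fun x => 3 * x - i%:R) @^-1` slice t (lo i) (hi i).
have lohi i : lo i <= hi i by rewrite /lo /hi; case: (b); [lra|case: ifP; lra].
have mP i : measurable (P i).
  rewrite /P -[X in measurable X]setTI.
  have : measurable_fun setT (fun x : R => 3 * x - i%:R).
    by apply: measurable_funB => //; exact: measurable_funM.
  by apply=> //; exact: measurable_slice.
have PE i : lambda (P i) = (3^-1 * (clamp 0 1 (hi i) - clamp 0 1 (lo i)))%:E.
  by rewrite lebesgue_measure_affine ?IH//; exact: measurable_slice.
have branchE i x : (i < 3)%N -> (lo i <= zigzag t (3 * x - i%:R) <= hi i) =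
    (u <= branch b i (zigzag t (3 * x - i%:R)) <= v).
  move=> i3; rewrite /branch /lo /hi; case: (b) => //.
    by apply/idP/idP; lra.
  by case: ifP => // _; apply/idP/idP; lra.
have -> : slice (b :: t) u v = P 0%N `|` P 1%N `|` P 2%N.
  have PS i x : (i < 3)%N -> P i x -> slice (b :: t) u v x.
    move=> i3 [xi]; rewrite branchE// => uxv.
    have xi' : i%:R <= 3 * x <= i.+1%:R by rewrite -natr1; lra.
    split; last by rewrite (zigzag_branch _ _ i3).
    have i2 : i%:R <= 2 :> R by rewrite ler_nat -ltnS.
    have i0 : 0 <= i%:R :> R by [].
    by lra.
  apply/seteqP; split=> x; last by case=> [[]|]; exact: PS.
  case=> x01 uxv; have [i i3 xi] := third_cell x01.
  have xi' : i%:R <= 3 * x <= i.+1%:R by case/andP: xi => -> /ltW.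
  have Pi : P i x.
    split; first by move: xi; rewrite -natr1; lra.
    by rewrite branchE// -zigzag_branch.
  by move: i i3 {xi xi'} Pi => [|[|[|//]]] _; [left; left|left; right|right].
have disj i j : i != j -> P i `&` P j = set0.
  wlog : i j / (i < j)%N => [H ij|ij _].
    by move: (ij); rewrite neq_ltn => /orP[/H->//|/H]; rewrite setIC => -> //; rewrite eq_sym.
  rewrite -subset0 => x [[xi _] [xj _]].
  have ijR : i%:R + 1 <= j%:R :> R by rewrite natr1 ler_nat.
  by lra.
have m01 : measurable (P 0%N `|` P 1%N) by exact: measurableU.
rewrite measureU; [|exact: m01|exact: mP|by rewrite setIUl !disj// setU0].
rewrite measureU; [|exact: mP|exact: mP|exact: disj].
apply: etrans (congr2 +%E (congr2 +%E (PE 0%N) (PE 1%N)) (PE 2%N)) _.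
rewrite -!EFinD; congr EFin; rewrite /lo /hi; case: (b) => /=.
  (* The three clamped lengths add up because a stacked step applied to [clamp 0 1] gives
     [clamp 0 1] back. *)
  have tri z : zigzag [:: true] z = zigzag [::] z.
    have [z0|z0] := leP z 0; first by rewrite (zigzag_le0 [:: true])// (zigzag_le0 [::]).
    have [z1|z1] := leP 1 z; first by rewrite (zigzag_ge1 [:: true])// (zigzag_ge1 [::]).
    have [|i i3 zi] := @third_cell _ z; first by rewrite (ltW z0).
    have zi' : i%:R <= 3 * z <= i.+1%:R by case/andP: zi => -> /ltW.
    rewrite (zigzag_branch _ _ i3 zi') /branch/= !clamp_id; [lra| |].
      by rewrite (ltW z0) (ltW z1).
    by move: zi'; rewrite -natr1; lra.
  by have := tri u; have := tri v; rewrite /= !subr0; lra.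
have flip z : clamp 0 1 (1 - z) = 1 - clamp 0 1 z.
  have [z0|z0] := leP z 0; first by rewrite clamp_ge// ?clamp_le//; lra.
  have [z1|z1] := leP 1 z; first by rewrite clamp_le ?clamp_ge//; lra.
  by rewrite !clamp_id//; lra.
by rewrite !flip; lra.
Qed.

End ZigzagMeasure.

(** * The limit function and the measure of its balls *)

Section RoughFunction.
Context {R : realType}.
Implicit Types (x y z u v : R) (s t : seq bool).
Local Notation lambda := (@lebesgue_measure R).

Definition cell_slice t j i u v : set R :=
  [set x | i%:R <= 3 ^+ j * x < i.+1%:R /\ u <= zigzag t x <= v].

Lemma measurable_cell_slice t j i u v : measurable (cell_slice t j i u v).
Proof.
have p0 : 0 < (3 : R) ^+ j by rewrite exprn_gt0.
have -> : cell_slice t j i u v =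
    `[i%:R / 3 ^+ j, i.+1%:R / 3 ^+ j[%classic `&` zigzag t @^-1` `[u, v]%classic.
  by apply/seteqP; split=> x /=;
    rewrite /cell_slice/= !in_itv/= ler_pdivrMr// ltr_pdivlMr// mulrC.
apply: measurableI => //; rewrite -[X in measurable X]setTI.
exact: measurable_zigzag.
Qed.

(** The column carries an affine copy of [zigzag s], so [slice_measure] applies to the rescaled
    interval [p, q]. The last clause places the centre of [p, q] in [0, 1] when (u + v) / 2 is a
    value taken in the column; [clamp_gap] needs this for lower bounds. *)
Lemma cell_slice_measure t s i u v : (i < 3 ^ size t)%N -> u <= v ->
  exists p q : R, [/\ q - p = 3 ^+ count id t * (v - u),
    lambda (cell_slice (t ++ s) (size t) i u v) =
      (3 ^- size t * (clamp 0 1 q - clamp 0 1 p))%:E &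
    forall x, i%:R <= 3 ^+ size t * x <= i.+1%:R ->
      2 * zigzag (t ++ s) x = u + v -> exists2 z, 0 <= z <= 1 & 2 * z = p + q].
Proof.
move=> it uv; have [e [sg [sgE H]]] := @zigzag_cell R _ _ it.
set n : R := 3 ^+ count id t; have n0 : 0 < n by rewrite exprn_gt0.
have p0 : 0 < (3 : R) ^+ size t by rewrite exprn_gt0.
pose p := if sg == 1 then n * (u - e) else n * (e - v).
pose q := if sg == 1 then n * (v - e) else n * (e - u).
have n1 : n^-1 * n = 1 by rewrite mulVf// gt_eqF.
have N11 : (-1 == 1 :> R) = false by apply/eqP; lra.
have pqE z : (u <= e + sg * (n^-1 * z) <= v) = (p <= z <= q).
  rewrite -[in RHS](mulVKf (lt0r_neq0 n0) z) /p /q.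
  by case: sgE => ->; rewrite ?eqxx ?N11 !ler_pM2l//; apply/idP/idP; lra.
exists p, q; split.
- by rewrite /p /q; case: ifP => _; ring.
- have -> : cell_slice (t ++ s) (size t) i u v =
      (fun x => 3 ^+ size t * x - i%:R) @^-1` slice s p q.
    apply/seteqP; split=> x [xi xuv].
      have xi' : i%:R <= 3 ^+ size t * x <= i.+1%:R by case/andP: xi => -> /ltW.
      by split; [rewrite -[i.+1%:R]natr1 in xi; lra|rewrite -pqE -H].
    have xi' : i%:R <= 3 ^+ size t * x <= i.+1%:R by rewrite -[i.+1%:R]natr1; lra.
    by split; [rewrite -[i.+1%:R]natr1; lra|rewrite H// pqE].
  rewrite lebesgue_measure_affine//; last exact: measurable_slice.
  rewrite slice_measure// /p /q.
  by case: ifP => _; rewrite ler_pM2l//; lra.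
- move=> x xi; rewrite H// => E; exists (zigzag s (3 ^+ size t * x - i%:R)).
    exact: zigzag01.
  rewrite -/n in E; set z := zigzag _ _ in E *.
  have -> : z = n * (n^-1 * z) by rewrite mulVKf// gt_eqF.
  rewrite /p /q; case: sgE E => ->; rewrite ?eqxx ?N11 => E.
    by rewrite -mulrDr mulrCA; congr (_ * _); lra.
  by rewrite -mulrDr mulrCA; congr (_ * _); lra.
Qed.

(** Either an end of the interval is not clipped, and a length of at least [h] remains, or both are
    and all of [0, 1] remains. The range up to 3 / 2 is the one that [rough_ball_lower] produces. *)
Lemma clamp_gap z h : 0 <= z <= 1 -> 0 <= h <= 3 / 2 ->
  h / 3 <= clamp 0 1 (z + h) - clamp 0 1 (z - h).
Proof.
move=> z01 h01; have [hl|hl] := leP (z - h) 0.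
  rewrite (clamp_le 1 hl); have [hr|hr] := leP 1 (z + h).
    by rewrite clamp_ge//; lra.
  by rewrite clamp_id; lra.
rewrite (@clamp_id _ _ _ (z - h)); last lra.
have [hr|hr] := leP 1 (z + h); first by rewrite clamp_ge//; lra.
by rewrite clamp_id; lra.
Qed.

Lemma nat_nearP i j : (i < j.+2)%N -> (j < i.+2)%N -> [\/ i = j.-1, i = j | i = j.+1].
Proof. move=> ? ?; have : i = j.-1 \/ i = j \/ i = j.+1 by lia.
by case=> [|[]] ->; [constructor 1|constructor 2|constructor 3]. Qed.

Section Limit.
Variable t : nat -> bool.

(** Every later approximation maps a column of width 3^-j onto an interval of length
    [3 ^- height j]. *)
Definition height j := count id (mkseq t j).
Definition approx j : R -> R := zigzag (mkseq t j).

Lemma height_leq j : (height j <= j)%N.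
Proof. by rewrite (leq_trans (count_size _ _))// size_mkseq. Qed.

Lemma mkseq_cat j k : (j <= k)%N -> exists s, mkseq t k = mkseq t j ++ s.
Proof.
move=> jk; exists (map t (iota j (k - j))).
by rewrite /mkseq -map_cat -{2}[j]add0n -iotaD subnKC.
Qed.

Lemma height_mono j k : (j <= k)%N -> (height j <= height k)%N.
Proof.
by move=> /mkseq_cat[s E]; rewrite /height E count_cat leq_addr.
Qed.

Lemma approx_dist j k x : (j <= k)%N -> `|approx j x - approx k x| <= 3 ^- height j.
Proof.
move=> /mkseq_cat[s E]; rewrite /approx E -{1}[mkseq t j]cats0.
exact: zigzag_prefix.
Qed.

(* The uniform limit of [approx], defined without appeal to completeness: every
   [approx j - 3^-height j] is below every [approx k + 3^-height k]. *)
Definition rough x : R := sup [set approx j x - 3 ^- height j | j in [set: nat]].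

Lemma rough_approx j x : `|approx j x - rough x| <= 3 ^- height j.
Proof.
have pos (k : nat) : 0 <= (3 : R) ^- k by rewrite invr_ge0 exprn_ge0.
have ub k l : approx k x - 3 ^- height k <= approx l x + 3 ^- height l.
  have [kl|/ltnW kl] := leqP k l.
    by have := approx_dist x kl; have := pos (height l); rewrite ler_distlC => ?; lra.
  by have := approx_dist x kl; have := pos (height k); rewrite ler_distlC => ?; lra.
rewrite ler_distlC; apply/andP; split.
  apply: ub_le_sup; last by exists j.
  by exists (approx 0 x + 3 ^- height 0) => _ [k _ <-]; exact: ub.
apply: ge_sup; last by move=> _ [k _ <-]; exact: ub.
by exists (approx 0 x - 3 ^- height 0); exists 0%N.
Qed.

Lemma rough_bounds x : -1 <= rough x <= 2.
Proof.
have := rough_approx 0 x; rewrite /height /= expr0 invr1.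
by have := zigzag01 (mkseq t 0) x; rewrite ler_distlC /approx => ? ?; lra.
Qed.

Hypothesis height_unbounded : forall M, exists j, (M <= height j)%N.

Lemma rough_approximable e : 0 < e -> exists j0, forall j x, (j0 <= j)%N ->
  `|approx j x - rough x| <= e.
Proof.
move=> e0; have [j0 j0P] := height_unbounded (Num.bound e^-1).
exists j0 => j x jj; apply: le_trans (rough_approx _ _) _.
rewrite -[leRHS]invrK lef_pV2 ?posrE ?invr_gt0 ?exprn_gt0//.
have := archi_boundP (ltW (_ : 0 < e^-1)); rewrite invr_gt0 => /(_ e0) /ltW/le_trans; apply.
apply: (@le_trans _ _ (height j)%:R).
  by rewrite ler_nat (leq_trans j0P)// height_mono.
by rewrite -natrX ler_nat ltnW// ltn_expl.
Qed.

Lemma rough_uniformly_continuous e : 0 < e -> exists2 d, 0 < d &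
  forall x y, `|x - y| <= d -> `|rough x - rough y| <= e.
Proof.
move=> e0; have e3 : 0 < e / 3 by rewrite divr_gt0.
have [j jP] := rough_approximable e3.
have p0 : 0 < (9 : R) ^+ j by rewrite exprn_gt0.
exists (e / 3 / 9 ^+ j); first by rewrite divr_gt0.
move=> x y; rewrite ler_pdivlMr// mulrC => xy.
have := zigzag_lip (mkseq t j) x y; rewrite size_mkseq => /le_trans/(_ xy).
have := jP j x (leqnn _); have := jP j y (leqnn _).
by rewrite /approx !ler_distlC => ? ? ?; lra.
Qed.

Lemma continuous_rough : continuous rough.
Proof.
move=> x; apply/cvgrPdist_le => e e0.
have [d d0 dP] := rough_uniformly_continuous e0.
have : \forall y \near x, `|x - y| < d by exact: nbhsx_ballx.
by apply: filterS => y /ltW; exact: dP.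
Qed.

Definition rough_ball x r : set R :=
  [set y | [/\ 0 <= y <= 1, `|x - y| <= r & `|rough x - rough y| <= r]].

Lemma measurable_rough_ball x r : measurable (rough_ball x r).
Proof.
have -> : rough_ball x r = `[0, 1]%classic `&` `[x - r, x + r]%classic `&`
    rough @^-1` `[rough x - r, rough x + r]%classic.
  apply/seteqP; split=> y /=; rewrite !in_itv/= /rough_ball/= !ler_distlC.
    by case=> h1 h2 h3; split=> //; split=> //; lra.
  by case=> [[h1 h2] h3]; split=> //; lra.
apply: measurableI; first exact: measurableI.
rewrite -[X in measurable X]setTI.
have : measurable_fun setT rough by apply: continuous_measurable_fun; exact: continuous_rough.
by apply=> //; exact: measurable_itv.
Qed.

(** The column of [x] alone has enough mass: its points where [approx k] is within r / 2 of
    [approx k x] lie in the ball, as each of the two passages from [approx k] to [rough] costs at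
    most r / 4. *)
Lemma rough_ball_lower j x r : 0 <= x <= 1 -> 3 ^- j <= r <= 3 * 3 ^- j ->
  ((r * 3 ^- j * 3 ^+ height j / 6)%:E <= lambda (rough_ball x r))%E.
Proof.
move=> x01 /andP[jr rj]; have p0 : 0 < (3 : R) ^+ j by rewrite exprn_gt0.
have r0 : 0 < r by rewrite (lt_le_trans _ jr)// invr_gt0.
have r4 : 0 < r / 4 by rewrite divr_gt0.
have [k0 k0P] := rough_approximable r4.
pose k := maxn j k0; have kP y := k0P k y (leq_maxr _ _).
have [s sE] := mkseq_cat (leq_maxl j k0 : (j <= k)%N).
have jE : size (mkseq t j) = j by rewrite size_mkseq.
(* Columns are half-open; x = 1 is assigned to the last one through its closed right end. *)
have [i ij xi] : exists2 i : nat, (i < 3 ^ j)%N & i%:R <= 3 ^+ j * x <= i.+1%:R.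
  have [x1|x1] := ltP x 1.
    have [|i ij /andP[i1 /ltW i2]] := @cellP _ x _ j; first lra.
    by exists i => //; rewrite i1.
  have -> : x = 1 by lra.
  exists (3 ^ j).-1; first by rewrite prednK// expn_gt0.
  by rewrite mulr1 prednK ?expn_gt0// -natrX ler_nat leq_pred lexx.
have uv : approx k x - r / 2 <= approx k x + r / 2 by lra.
have ij' : (i < 3 ^ size (mkseq t j))%N by rewrite jE.
have [p [q [pq mE zP]]] := cell_slice_measure s ij' uv.
have [||z z01 zE] := zP x; [by rewrite jE|by rewrite -sE -/(approx k x); ring|].
apply: (@le_trans _ _ (lambda (cell_slice (mkseq t j ++ s) (size (mkseq t j)) i
  (approx k x - r / 2) (approx k x + r / 2)))).
  rewrite mE lee_fin jE -/(height j) in pq *.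
  pose h := 3 ^+ height j * r / 2.
  have [pE qE] : p = z - h /\ q = z + h by rewrite /h; lra.
  have h0 : 0 <= h by rewrite /h divr_ge0// mulr_ge0 ?exprn_ge0// ltW.
  have h1 : h <= 3 / 2.
    rewrite /h ler_wpM2r//; apply: le_trans (_ : 3 ^+ j * r <= _).
      by rewrite ler_wpM2r ?(ltW r0)// ler_weXn2l ?height_leq// ler1n.
    by rewrite mulrC -ler_pdivlMr.
  have := @clamp_gap z h z01; rewrite h0 h1 -pE -qE => /(_ isT) gap.
  apply: (@le_trans _ _ (3 ^- j * (h / 3))).
    by rewrite /h le_eqVlt; apply/orP; left; apply/eqP; field; rewrite gt_eqF.
  by rewrite ler_wpM2l// invr_ge0 ltW.
apply: le_measure; rewrite ?inE; [exact: measurable_cell_slice|exact: measurable_rough_ball|].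
rewrite -sE jE => y [yi yuv].
have yx : `|3 ^+ j * (x - y)| <= 1.
  by rewrite -[i.+1%:R]natr1 in xi yi; rewrite mulrBr ler_distlC; lra.
split.
- have i1 : i%:R + 1 <= 3 ^+ j :> R by rewrite natr1 -natrX ler_nat.
  have i0 : 0 <= i%:R :> R by [].
  rewrite -[i.+1%:R]natr1 in yi; apply/andP; split; rewrite -(ler_pM2l p0); lra.
- by rewrite (le_trans _ jr)// -[leRHS]mul1r ler_pdivlMr// mulrC -{1}(gtr0_norm p0) -normrM.
- have := kP x; have := kP y; rewrite /approx in yuv *.
  by rewrite !ler_distlC => ? ?; lra.
Qed.

(** A ball of radius at most 3^-j meets at most three adjacent columns, each contributing at most 6
    * r * 3^-j * 3^n with n = [height j]. *)
Lemma rough_ball_upper j x r : 0 <= x <= 1 -> 0 < r <= 3 ^- j ->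
  (lambda (rough_ball x r) <= (18 * r * 3 ^- j * 3 ^+ height j)%:E)%E.
Proof.
move=> x01 /andP[r0 rj]; have p0 : 0 < (3 : R) ^+ j by rewrite exprn_gt0.
have [k0 k0P] := rough_approximable r0.
pose k := maxn j k0; have kP y := k0P k y (leq_maxr _ _).
have [s sE] := mkseq_cat (leq_maxl j k0 : (j <= k)%N).
have jE : size (mkseq t j) = j by rewrite size_mkseq.
(* 3 * r is [r] plus an approximation error of at most [r] at each of the two points. *)
pose u := approx k x - 3 * r; pose v := approx k x + 3 * r.
have uv : u <= v by rewrite /u /v; lra.
pose c := 6 * r * 3 ^- j * 3 ^+ height j.
pose S i := if (i < 3 ^ j)%N then cell_slice (mkseq t k) j i u v else set0.
have mS i : measurable (S i).
  by rewrite /S; case: ifP => // _; exact: measurable_cell_slice.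
have Sc i : (lambda (S i) <= c%:E)%E.
  rewrite /S; case: ifPn => [ij|_]; last first.
    by rewrite measure0 lee_fin /c !mulr_ge0 ?invr_ge0 ?exprn_ge0// ltW.
  have ij' : (i < 3 ^ size (mkseq t j))%N by rewrite jE.
  have [p [q [pq mE _]]] := cell_slice_measure s ij' uv.
  rewrite jE -/(height j) in pq mE; rewrite sE mE lee_fin.
  have pq0 : p <= q.
    by rewrite -subr_ge0 pq mulr_ge0 ?exprn_ge0//; rewrite /u /v; lra.
  apply: (@le_trans _ _ (3 ^- j * (q - p))).
    by rewrite ler_wpM2l ?invr_ge0 ?exprn_ge0// clamp_lip.
  by rewrite pq /c /u /v le_eqVlt; apply/orP; left; apply/eqP; ring.
pose i0 := Num.truncn (3 ^+ j * x).
have xi : i0%:R <= 3 ^+ j * x < i0.+1%:R.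
  by apply: truncn_itv; rewrite mulr_ge0// ?(ltW p0)//; case/andP: x01.
(* The point 1 lies in none of the half-open columns. If [i0] is 0, then [i0.-1] merely repeats
   column 0. *)
have m1 := measurableU _ _ (@measurable_set1 R 1) (mS i0.-1).
have m2 := measurableU _ _ m1 (mS i0).
have m3 := measurableU _ _ m2 (mS i0.+1).
apply: (@le_trans _ _ (lambda ([set 1] `|` S i0.-1 `|` S i0 `|` S i0.+1))).
  apply: le_measure; rewrite ?inE; [exact: measurable_rough_ball|exact: m3|].
  move=> y [y01 yx wyx]; have [->|y1] := eqVneq y 1; first by left; left; left.
  have [|i ij yi] := @cellP _ y _ j; first by rewrite lt_neqAle y1; case/andP: y01 => -> ->.
  have Si : S i y.
    rewrite /S ij; split=> //; rewrite /u /v.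
    have := kP x; have := kP y; rewrite /approx !ler_distlC in wyx * => ? ?; lra.
  have yx1 : `|3 ^+ j * x - 3 ^+ j * y| <= 1.
    rewrite -mulrBr normrM (gtr0_norm p0) mulrC -ler_pdivlMr// div1r.
    exact: le_trans yx rj.
  have ii0 : (i < i0.+2)%N.
    by rewrite -(ltr_nat R) -[i0.+2%:R]natr1; rewrite ler_distlC in yx1; lra.
  have i0i : (i0 < i.+2)%N.
    by rewrite -(ltr_nat R) -[i.+2%:R]natr1; rewrite ler_distlC in yx1; lra.
  have [E|E|E] := nat_nearP ii0 i0i.
  + by left; left; right; rewrite -E.
  + by left; right; rewrite -E.
  + by right; rewrite -E.
have -> : 18 * r * 3 ^- j * 3 ^+ height j = 0 + c + c + c by rewrite /c; ring.
rewrite !EFinD.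
apply: (@le_trans _ _ _ _ _ (measureU2 lambda m2 (mS _))); apply: leeD; last exact: Sc.
apply: (@le_trans _ _ _ _ _ (measureU2 lambda m1 (mS _))); apply: leeD; last exact: Sc.
apply: (@le_trans _ _ _ _ _ (measureU2 lambda (@measurable_set1 R 1) (mS _))); apply: leeD; last exact: Sc.
by rewrite le_eqVlt; apply/orP; left; apply/eqP; exact: lebesgue_measure_set1.
Qed.

End Limit.

End RoughFunction.

(** * Choice of the stacked steps and the resulting exponent *)

Section Exponents.
Context {R : realType} (theta : R).
Hypothesis theta01 : 0 <= theta <= 1.
Local Notation lambda := (@lebesgue_measure R).

(* The disjunct [n * n <= j] keeps the count unbounded when theta = 0, at the
   cost of a sublinear error only. *)
Fixpoint stack_count j : nat :=
  if j is i.+1 then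
    let n := stack_count i in
    (n%:R <= theta * i%:R + 1) || (n * n <= i)%N + n
  else 0.

Definition stack j : bool :=
  let n := stack_count j in (n%:R <= theta * j%:R + 1) || (n * n <= j)%N.

Lemma height_stack j : height stack j = stack_count j.
Proof.
elim: j => // j IH; rewrite /height mkseqS -cats1 count_cat -/(height stack j) IH.
by rewrite /= addn0 addnC.
Qed.

(** This is what the [+ 1] in the rule is for: a step is not stacked only if the count exceeds theta
    * j + 1, which is at least theta * (j + 1). *)
Lemma height_stack_ge j : theta * j%:R <= (height stack j)%:R.
Proof.
rewrite height_stack; elim: j => [|j IH] /=; first by rewrite mulr0.
rewrite -[j.+1%:R]natr1 mulrDr mulr1; have /andP[t0 t1] := theta01.
have [_|/norP[h _]] := boolP (_ || _).
  by rewrite add1n -[_.+1%:R]natr1; lra.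
by rewrite add0n; move: h; rewrite -ltNge; lra.
Qed.

(** Only a stacked step raises the count, so the bound valid at the last stacked step, of whichever
    kind, persists. *)
Lemma height_stack_le j : (height stack j)%:R <= theta * j%:R + 2 \/
  ((height stack j).-1 * (height stack j).-1 <= j)%N.
Proof.
rewrite height_stack; elim: j => [|j IH] /=; first by right.
rewrite -[j.+1%:R]natr1; have /andP[t0 t1] := theta01.
have [/orP[h|h]|_] := boolP (_ || _).
- by left; rewrite add1n -[_.+1%:R]natr1; lra.
- by right; rewrite add1n/= (leq_trans h).
- rewrite add0n; case: IH => IH; first by left; lra.
  by right; rewrite (leq_trans IH).
Qed.

Lemma height_stack_unbounded M : exists j, (M <= height stack j)%N.
Proof.
elim: M => [|M [j Mj]]; first by exists 0%N.
pose k := maxn j (M * M).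
have Mk : (M <= height stack k)%N by rewrite (leq_trans Mj)// height_mono// leq_maxl.
move: Mk; rewrite leq_eqVlt => /orP[/eqP Mk|Mk]; last by exists k.
exists k.+1; rewrite !height_stack/= -height_stack -Mk.
by rewrite (_ : (M * M <= k)%N) ?orbT ?add1n// leq_maxr.
Qed.

Lemma triadic_scale (r : R) : 0 < r <= 1 -> exists j, 3 ^- j <= r <= 3 * 3 ^- j.
Proof.
move=> /andP[r0 r1].
have ex : exists j, (3 : R) ^- j <= r.
  exists (Num.bound r^-1); rewrite -[leRHS]invrK lef_pV2 ?posrE ?invr_gt0 ?exprn_gt0//.
  have rb : r^-1 < (Num.bound r^-1)%:R by rewrite archi_boundP// invr_ge0 ltW.
  apply: le_trans (ltW rb) _; rewrite -natrX ler_nat ltnW// ltn_expl//.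
case: (ex_minnP ex) => -[|j] jr jmin; first by exists 0%N; rewrite jr expr0 invr1; lra.
exists j.+1; rewrite jr/= exprS invfM mulrA mulfV// mul1r ltW// ltNge.
by apply/negP => /jmin; rewrite ltnn.
Qed.

Lemma expr3_powR n : 3 ^+ n = (3 : R) `^ n%:R.
Proof. by rewrite powR_mulrn. Qed.

Lemma rough_ball_ge : exists2 C, 0 < C & forall x r, 0 <= x <= 1 -> 0 < r <= 1 ->
  ((C * r `^ (2 - theta))%:E <= lambda (rough_ball stack x r))%E.
Proof.
(* 18 = 6 * 3, as 3^-j >= r / 3 in [rough_ball_lower]. *)
exists (18^-1); rewrite ?invr_gt0// => x r x01 r01.
have [j jr] := triadic_scale r01; have /andP[r0 r1] := r01.
apply: le_trans (rough_ball_lower height_stack_unbounded x01 jr); rewrite lee_fin.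
have /andP[j1 j2] := jr; have p0 : 0 < (3 : R) ^- j by rewrite invr_gt0 exprn_gt0.
have : r `^ (- theta) <= 3 ^+ height stack j.
  rewrite powRN -powRV ?(ltW r0)//.
  apply: (@le_trans _ _ ((3 ^+ j) `^ theta)).
    rewrite ge0_ler_powR ?nnegrE ?invr_ge0 ?exprn_ge0 ?(ltW r0)//; first by case/andP: theta01.
    by rewrite -[leRHS]invrK lef_pV2 ?posrE ?invr_gt0 ?exprn_gt0.
  rewrite !expr3_powR -powRrM ler_powR ?ler1n//.
  by rewrite mulrC height_stack_ge.
have -> : r `^ (2 - theta) = r ^+ 2 * r `^ (- theta).
  by rewrite powRD ?(gt_eqF r0) ?implybT// -powR_mulrn ?(ltW r0).
move=> h; have h0 := powR_ge0 r (- theta).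
set H := 3 ^+ height stack j in h *; have H0 : 0 <= H by rewrite exprn_ge0.
apply: (@le_trans _ _ (18^-1 * (r ^+ 2 * H))); first by rewrite !ler_wpM2l ?sqr_ge0.
have : r * r * H <= r * (3 * 3 ^- j) * H by rewrite ler_wpM2r// ler_wpM2l// ltW.
by lra.
Qed.

Lemma rough_ball_le e : 0 < e -> exists2 C, 0 < C & forall x r,
  0 <= x <= 1 -> 0 < r <= 1 ->
  (lambda (rough_ball stack x r) <= (C * r `^ (2 - theta - e))%:E)%E.
Proof.
(* [c] bounds the excess of the count over (theta + e) * j: it is at most 2 in the first case of
   [height_stack_le], and in the second sqrt j + 1 <= e * j + (4 * e)^-1 + 1. *)
move=> e0; pose c := 2 + (4 * e)^-1; have c0 : 0 < c by rewrite addr_gt0 ?invr_gt0 ?mulr_gt0.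
pose C := 54 * (3 `^ c * 3 `^ (theta + e)).
exists C => [|x r x01 r01]; first by rewrite !mulr_gt0 ?powR_gt0.
have [j /andP[jr rj]] := triadic_scale r01; have /andP[r0 r1] := r01.
(* [rough_ball_upper] wants a column at least as wide as [r], so it is applied one scale up; this
   costs the factor 3 in 54 = 18 * 3. *)
have h1 : 0 < r <= 3 ^- j.-1.
  rewrite r0; case: j jr rj => [|j] _ rj /=; first by rewrite expr0 invr1.
  by move: rj; rewrite exprS invfM mulrA mulfV// mul1r.
apply: le_trans (rough_ball_upper height_stack_unbounded x01 h1) _; rewrite lee_fin.
have p0 : 0 < (3 : R) ^- j by rewrite invr_gt0 exprn_gt0.
have h2 : (3 : R) ^- j.-1 <= 3 * r.
  apply: le_trans (_ : 3 * 3 ^- j <= _); last by rewrite ler_wpM2l.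
  case: j {jr rj h1 p0} => [|j] /=; first by rewrite expr0 invr1; lra.
  by rewrite exprS invfM mulrA mulfV// mul1r.
have h3 : (3 : R) ^+ height stack j.-1 <= 3 `^ c * 3 `^ (theta + e) * r `^ (- (theta + e)).
  apply: (@le_trans _ _ (3 `^ (c + (theta + e) * j%:R))).
    rewrite expr3_powR ler_powR ?ler1n//.
    apply: (@le_trans _ _ (height stack j)%:R); first by rewrite ler_nat height_mono// leq_pred.
    have e4 : 0 < (4 * e)^-1 by rewrite invr_gt0 mulr_gt0.
    have ej : 0 <= e * j%:R by rewrite mulr_ge0// ltW.
    case: (height_stack_le j) => h; first by rewrite /c [(theta + e) * _]mulrDl; lra.
    set n := height stack j in h *.
    have n1 : n%:R <= n.-1%:R + 1 :> R by rewrite natr1 ler_nat leqSpred.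
    have nj : n.-1%:R * n.-1%:R <= j%:R :> R by rewrite -natrM ler_nat.
    have amgm : n.-1%:R <= e * (n.-1%:R * n.-1%:R) + (4 * e)^-1 :> R.
      have E : e * (n.-1%:R * n.-1%:R) + (4 * e)^-1 - n.-1%:R =
          (2 * e * n.-1%:R - 1) ^+ 2 / (4 * e) by field; rewrite gt_eqF.
      by rewrite -subr_ge0 E divr_ge0 ?sqr_ge0// mulr_ge0// ltW.
    have := ler_wpM2l (ltW e0) nj.
    have : 0 <= theta * j%:R by rewrite mulr_ge0//; case/andP: theta01.
    by rewrite /c [(theta + e) * _]mulrDl; lra.
  rewrite [leLHS]powRD ?(gt_eqF (ltr0n R 3)) ?implybT// -mulrA ler_wpM2l ?powR_ge0//.
  rewrite mulrC powRrM -expr3_powR powRN -powRV ?(ltW r0)// -powRM ?invr_ge0 ?(ltW r0)//.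
  rewrite ge0_ler_powR ?nnegrE ?exprn_ge0 ?mulr_ge0 ?invr_ge0 ?(ltW r0)//.
    by rewrite addr_ge0 ?(ltW e0)//; case/andP: theta01.
  by rewrite ler_pdivlMr// mulrC -ler_pdivlMr ?exprn_gt0.
rewrite (_ : 2 - theta - e = 2 + - (theta + e)); last ring.
rewrite powRD ?(gt_eqF r0) ?implybT// (powR_mulrn 2 (ltW r0)) /C.
set P := r `^ _ in h3 *; set D := _ * 3 `^ (theta + e) in h3 *.
set H := 3 ^+ _ in h3 *.
apply: (@le_trans _ _ (18 * r * (3 * r) * (D * P))); last by lra.
by rewrite ler_pM// ?mulr_ge0 ?exprn_ge0 ?invr_ge0 ?exprn_ge0 ?(ltW r0)// ler_wpM2l ?mulr_ge0 ?(ltW r0).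
Qed.

End Exponents.

(** * Graphs comparable to that of the rough function *)

Section RoughGraph.
Context {R : realType}.
Variables (a b c d theta K1 : R) (H : R * R -> R).
Hypotheses (ab : a < b) (cd : c < d) (theta01 : 0 <= theta <= 1) (K1_ge0 : 0 <= K1).
Local Notation w := (rough (stack theta)).
Local Notation lambda := (@lebesgue_measure R).
Let unit_square : set (R * R) := `[0, 1]%classic `*` `[0, 1]%classic.
Let param (q : R * R) := (a + (b - a) * q.1, c + (d - c) * q.2).
Let G (q : R * R) : 'rV[R]_3 :=
  \row_(i < 3) [:: (param q).1; (param q).2; H q]`_i.

(** Together with [H_lower], this makes the graph of [H] bi-Lipschitz to that of [w] extended
    constantly in the second variable. *)
Hypothesis H_upper : forall q q', unit_square q -> unit_square q' ->
  `|H q - H q'| <= K1 * (`|q.1 - q'.1| + `|q.2 - q'.2| + `|w q.1 - w q'.1|).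
Hypothesis H_lower : forall q q', unit_square q -> unit_square q' ->
  `|w q.1 - w q'.1| <= K1 * (`|q.1 - q'.1| + `|q.2 - q'.2| + `|H q - H q'|).

Let side (v r : R) : set R := [set z | 0 <= z <= 1 /\ `|v - z| <= r].
Let B (q : R * R) r : set (R * R) := rough_ball (stack theta) q.1 r `*` side q.2 r.

Let measurable_side v r : measurable (side v r).
Proof.
have -> : side v r = `[0, 1]%classic `&` `[v - r, v + r]%classic.
  by apply/seteqP; split=> z /=; rewrite /side/= !in_itv/= ler_distlC => -[h1 h2]; split.
exact: measurableI.
Qed.

Let side_measure v r : 0 <= v <= 1 -> 0 <= r ->
  lambda (side v r) = (clamp 0 1 (v + r) - clamp 0 1 (v - r))%:E.
Proof.
move=> v01 r0; have le1 : clamp 0 1 (v - r) <= clamp 0 1 (v + r).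
  by apply: clamp_mono; lra.
have -> : side v r = `[clamp 0 1 (v - r), clamp 0 1 (v + r)]%classic.
  have [/andP[lo0 lo1] /andP[hi0 hi1]] :=
    (@clamp_itv R 0 1 (v - r) ler01, @clamp_itv R 0 1 (v + r) ler01).
  apply/seteqP; split=> z /=; rewrite /side/= !in_itv/= ler_distlC.
    move=> [z01 /andP[z1 z2]]; rewrite -(clamp_id z01).
    by rewrite !clamp_mono.
  move=> /andP[z1 z2]; have z01 : 0 <= z <= 1 by lra.
  split=> //; apply/andP; split; rewrite leNgt; apply/negP => h.
    by move: z1; rewrite leNgt clamp_id ?h//; lra.
  by move: z2; rewrite leNgt clamp_id ?h//; lra.
rewrite lebesgue_measure_itv/= lte_fin lt_neqAle le1 andbT.
by have [->|] := eqVneq; rewrite ?subrr.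
Qed.

Local Notation mu := (lambda \x lambda)%E.

Let B_measure q r : mu (B q r) = (lambda (rough_ball (stack theta) q.1 r) * lambda (side q.2 r))%E.
Proof.
apply: product_measure1E; [exact: measurable_rough_ball (height_stack_unbounded _) _ _|exact: measurable_side].
Qed.

Let ballE (x y : 'rV[R]_3) r : eucl_dist x y <= r -> forall i, `|x ord0 i - y ord0 i| <= r.
Proof.
move=> xy i; apply: le_trans xy; rewrite -sqrtr_sqr ler_wsqrtr//.
by rewrite (bigD1 i)//= lerDl sumr_ge0// => j _; exact: sqr_ge0.
Qed.

Let ballI (x y : 'rV[R]_3) r : (forall i, `|x ord0 i - y ord0 i| <= r) -> eucl_dist x y <= 2 * r.
Proof.
move=> xy; have r0 : 0 <= r := le_trans (normr_ge0 _) (xy ord0).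
rewrite -[leRHS]ger0_norm ?mulr_ge0// -sqrtr_sqr ler_wsqrtr//.
apply: (@le_trans _ _ (\sum_(i < 3) r ^+ 2)).
  by apply: ler_sum => i _; rewrite -[leLHS]real_normK ?num_real// lerXn2r ?nnegrE.
by rewrite sumr_const card_ord -[leLHS]mulr_natl; nra.
Qed.

Let mu_unit_square : mu unit_square = 1%E.
Proof.
have l01 : lambda `[0, 1]%classic = 1%E.
  by rewrite lebesgue_measure_itv/= lte_fin ltr01 oppr0 adde0.
apply: etrans; first exact: product_measure1E.
by apply: etrans (congr2 *%E l01 l01) _; rewrite mule1.
Qed.

Lemma rough_graph_has_dim dim : has_dim dim (G @` unit_square) (3 - theta).
Proof.
have ba0 : 0 < b - a by rewrite subr_gt0.
have dc0 : 0 < d - c by rewrite subr_gt0.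
have [t0 t1] := andP theta01.
pose K2 := 1 + (b - a)^-1 + (d - c)^-1.
(* The middle term serves [B_in] and the last one [B_out]; its factor 2 passes from coordinatewise
   to Euclidean distance. *)
pose K := 1 + (1 + K1) * K2 + 2 * ((b - a) + (d - c) + 3 * K1).
have iba : 0 < (b - a)^-1 by rewrite invr_gt0.
have idc : 0 < (d - c)^-1 by rewrite invr_gt0.
have K2_ge1 : 1 <= K2 by rewrite /K2; lra.
have K1K2 : 0 <= K1 * K2 by rewrite mulr_ge0// (le_trans ler01).
have KE : K = 1 + K2 + K1 * K2 + 2 * ((b - a) + (d - c) + 3 * K1) by rewrite /K; ring.
apply: (@regular_has_dim R 3 _ (measurableTypeR R * measurableTypeR R)%type mu unit_square G B K) => //.
- exact: measurableX.
- by apply: (eq_ind_r (fun z => z < +oo)%E _ mu_unit_square); rewrite ltry.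
- exact: (eq_ind_r (fun z => 0 < z)%E lte01 mu_unit_square).
- move=> q r; apply: measurableX; last exact: measurable_side.
  exact: measurable_rough_ball (height_stack_unbounded _) _ _.
- move=> q r q' [[q1 _ _] [q2 _]]; split => /=; rewrite in_itv/=; [exact: q1|exact: q2].
- rewrite KE; have := K1_ge0; lra.
- move=> q q' r Xq Xq' r0 /ballE h.
  have h0 := h ord0; have h1 := h (lift ord0 ord0); have h2 := h ord_max.
  rewrite !mxE/= in h0 h1 h2.
  have e1 : `|q.1 - q'.1| <= (b - a)^-1 * r.
    rewrite mulrC ler_pdivlMr// mulrC -{1}(gtr0_norm ba0) -normrM.
    by move: h0; rewrite (_ : _ - _ = (b - a) * (q.1 - q'.1))//; ring.
  have e2 : `|q.2 - q'.2| <= (d - c)^-1 * r.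
    rewrite mulrC ler_pdivlMr// mulrC -{1}(gtr0_norm dc0) -normrM.
    by move: h1; rewrite (_ : _ - _ = (d - c) * (q.2 - q'.2))//; ring.
  have e3 : `|w q.1 - w q'.1| <= K1 * K2 * r.
    apply: le_trans (H_lower Xq Xq') _; rewrite -mulrA ler_wpM2l// /K2.
    by lra.
  have K2r : 0 <= K2 * r by rewrite mulr_ge0//; lra.
  have K12r : 0 <= K1 * K2 * r by rewrite mulr_ge0.
  have K1r : 0 <= K1 * r by rewrite mulr_ge0.
  have bar : 0 <= (b - a) * r by rewrite mulr_ge0// ltW.
  have dcr : 0 <= (d - c) * r by rewrite mulr_ge0// ltW.
  have iar : 0 <= (b - a)^-1 * r by rewrite mulr_ge0// ltW.
  have icr : 0 <= (d - c)^-1 * r by rewrite mulr_ge0// ltW.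
  have KrE : K * r = r + (r + (b - a)^-1 * r + (d - c)^-1 * r) + K1 * K2 * r +
      2 * ((b - a) * r + (d - c) * r + 3 * (K1 * r)) by rewrite KE /K2; ring.
  have Kr1 : (b - a)^-1 * r <= K * r by rewrite KrE; lra.
  have Kr2 : (d - c)^-1 * r <= K * r by rewrite KrE; lra.
  have Kr3 : K1 * K2 * r <= K * r by rewrite KrE; lra.
  case: Xq' => /=; rewrite !in_itv/= => q1 q2.
  split; split => //=; [exact: le_trans e1 Kr1|exact: le_trans e3 Kr3|exact: le_trans e2 Kr2].
- move=> q q' r Xq [[q1 e1 e3] [q2 e2]].
  have r0 : 0 <= r := le_trans (normr_ge0 _) e1.
  have Xq' : unit_square q' by split; rewrite /= in_itv.
  have K12r : 0 <= K1 * K2 * r by rewrite mulr_ge0.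
  have K2r : 0 <= K2 * r by rewrite mulr_ge0//; lra.
  have K1r : 0 <= K1 * r by rewrite mulr_ge0.
  have bar : 0 <= (b - a) * r by rewrite mulr_ge0// ltW.
  have dcr : 0 <= (d - c) * r by rewrite mulr_ge0// ltW.
  have KrE : K * r = r + K2 * r + K1 * K2 * r + 2 * ((b - a) * r + (d - c) * r + 3 * (K1 * r)).
    by rewrite KE; ring.
  apply: (@le_trans _ _ (2 * ((b - a) * r + (d - c) * r + 3 * (K1 * r)))); last first.
    by rewrite KrE; lra.
  apply: ballI; case=> -[|[|[|//]]] i3; rewrite !mxE/=.
  + rewrite (_ : _ - _ = (b - a) * (q.1 - q'.1)); last ring.
    rewrite normrM (gtr0_norm ba0).
    have : (b - a) * `|q.1 - q'.1| <= (b - a) * r by rewrite ler_pM2l.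
    by lra.
  + rewrite (_ : _ - _ = (d - c) * (q.2 - q'.2)); last ring.
    rewrite normrM (gtr0_norm dc0).
    have : (d - c) * `|q.2 - q'.2| <= (d - c) * r by rewrite ler_pM2l.
    by lra.
  + have h := H_upper Xq Xq'.
    have : K1 * (`|q.1 - q'.1| + `|q.2 - q'.2| + `|w q.1 - w q'.1|) <= K1 * (r + r + r).
      by rewrite ler_wpM2l// !lerD.
    by lra.
- by rewrite subr_gt0 (le_lt_trans t1)// ltr1n.
- move=> s /andP[s0 sbeta].
  (* This loss turns the exponent 2 - theta - e into s - 1; [side] supplies the missing factor
     [r]. *)
  have e0 : 0 < 3 - theta - s by rewrite subr_gt0.
  have [C C0 CP] := rough_ball_le theta01 e0.
  exists (C * 2); rewrite ?mulr_gt0// => q r [/=]; rewrite !in_itv/= => q1 q2 /andP[r0 r1].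
  rewrite B_measure side_measure//.
  have gap : clamp 0 1 (q.2 + r) - clamp 0 1 (q.2 - r) <= 2 * r.
    by apply: le_trans (clamp_lip _ _ _) _; lra.
  have [rE|rpos] := eqVneq r 0.
    by rewrite rE addr0 subr0 subrr mule0 lee_fin !mulr_ge0 ?powR_ge0// ltW.
  have rgt0 : 0 < r by rewrite lt_neqAle eq_sym rpos.
  have := CP q.1 r; rewrite q1 rgt0 r1 => /(_ isT isT) h.
  apply: le_trans (lee_pmul _ _ h (_ : (_ <= (2 * r)%:E)%E)) _ => //.
  + by rewrite lee_fin subr_ge0 clamp_mono//; lra.
  rewrite -EFinM lee_fin (_ : 2 - theta - (3 - theta - s) = s - 1); last ring.
  have -> : r `^ s = r `^ (s - 1) * r.
    by rewrite -[X in _ * X]powRr1// -powRD ?subrK// (negbTE rpos) implybT.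
  by rewrite le_eqVlt; apply/orP; left; apply/eqP; ring.
- move=> s sbeta; have [C C0 CP] := rough_ball_ge theta01.
  exists (C / 3); rewrite ?divr_gt0// => q r [/=]; rewrite !in_itv/= => q1 q2 /andP[r0 r1].
  rewrite B_measure side_measure// ?(ltW r0)//.
  have r32 : 0 <= r <= 3 / 2 by lra.
  have gap := clamp_gap q2 r32.
  have := CP q.1 r; rewrite q1 r0 r1 => /(_ isT isT) h.
  apply: le_trans (lee_pmul _ _ h (_ : ((r / 3)%:E <= _)%E)) => //.
  + rewrite -EFinM lee_fin.
    have -> : C * r `^ (2 - theta) * (r / 3) = C / 3 * r `^ (3 - theta).
      have -> : r `^ (3 - theta) = r `^ (2 - theta) * r.
        rewrite -[X in _ * X]powRr1 ?(ltW r0)// -powRD ?(gt_eqF r0) ?implybT//.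
        by congr (_ `^ _); ring.
      by ring.
    by rewrite ler_pM2l ?divr_gt0// ger_powR ?r0// ltW.
  + by rewrite lee_fin mulr_ge0 ?powR_ge0// ltW.
  + by rewrite lee_fin divr_ge0// ltW.
Qed.

End RoughGraph.

(** * Iterated integrals and partial derivatives *)

Section Primitive.
Context {R : realType}.
Variables (lo hi : R).
Hypothesis lohi : lo <= hi.
Implicit Types (u v w : R -> R) (x y k e : R).
Local Notation lambda := (@lebesgue_measure R).

(** Clamping extends the primitive by constants beyond [lo, hi], so that bounds and uniform
    continuity hold on the whole line and integration can be iterated without side conditions. *)
Definition primitive u x : R := (\int[lambda]_(t in `[lo, clamp lo hi x]) u t)%R.

Let integrable u x y : continuous u -> lambda.-integrable `[x, y]%classic (EFin \o u).
Proof.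
move=> uc; apply: continuous_compact_integrable; first exact: segment_compact.
exact: continuous_subspaceT.
Qed.

(** The combination is a first-order remainder G(x') - G(x) - F(x) * (x' - x), to be integrated in
    the other variable. *)
Lemma primitive_lin u v w k x : continuous u -> continuous v -> continuous w ->
  primitive (fun t => u t - v t - w t * k) x =
  primitive u x - primitive v x - primitive w x * k.
Proof.
move=> uc vc wc; rewrite /primitive RintegralB//.
- by rewrite RintegralB// ?RintegralZr//; exact: integrable.
- apply: integrable => z; apply: cvgB; [exact: uc|exact: vc].
- apply: integrable => z; apply: cvgM; [exact: wc|exact: cvg_cst].
Qed.

Lemma primitive_increment u k e x y : continuous u -> lo <= x -> x <= y -> y <= hi ->
  (forall t, x <= t <= y -> `|u t - k| <= e) ->
  `|primitive u y - primitive u x - k * (y - x)| <= e * (y - x).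
Proof.
move=> uc lx xy yh ue; rewrite /primitive !clamp_id ?lx ?(le_trans lx)// ?(le_trans xy)//.
have ioc v : continuous v -> lambda.-integrable `]x, y]%classic (EFin \o v).
  move=> vc; apply: integrableS (integrable x y vc) => //.
  by apply: subset_itvr; rewrite bnd_simp.
have icst (z : R) : lambda.-integrable `]x, y]%classic (EFin \o cst z).
  by apply: ioc => ?; exact: cvg_cst.
have iuk : lambda.-integrable `]x, y]%classic (EFin \o (fun t => u t - k)).
  by apply: ioc => z; apply: cvgB; [exact: uc|exact: cvg_cst].
have lE (z : R) : (\int[lambda]_(t in `]x, y]) z)%R = z * (y - x).
  have muE : lambda `]x, y]%classic = (y - x)%:E.
    rewrite lebesgue_measure_itv/= lte_fin.
    by move: xy; rewrite le_eqVlt => /predU1P[->|->]; first by rewrite ltxx subrr.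
  by rewrite Rintegral_cst//; congr (_ * _); exact: (congr1 fine muE).
rewrite Rintegral_itvB ?bnd_simp//; last exact: integrable.
rewrite -lE -RintegralB//; [|exact: ioc|exact: icst].
apply: le_trans (le_normr_Rintegral _ iuk) _ => //.
rewrite -lE; apply: le_Rintegral => //.
- exact: integrable_norm iuk.
- exact: icst.
- by move=> t /=; rewrite in_itv/= => /andP[/ltW xt ty]; apply: ue; rewrite xt.
Qed.

(** With [u x] for [k] this is the fundamental theorem of calculus in quantitative form; with 0 for
    [k] it is a Lipschitz bound. *)
Lemma primitive_diff u k e x y : continuous u -> lo <= x <= hi -> lo <= y <= hi ->
  (forall t, `|t - x| <= `|y - x| -> `|u t - k| <= e) ->
  `|primitive u y - primitive u x - k * (y - x)| <= e * `|y - x|.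
Proof.
move=> uc /andP[lx xh] /andP[ly yh] ue; have [xy|/ltW yx] := leP x y.
  rewrite [in leRHS]ger0_norm ?subr_ge0//; apply: primitive_increment => // t /andP[xt ty].
  by apply: ue; rewrite !ger0_norm ?subr_ge0// lerD2r.
rewrite -normrN (_ : - (_ - _ - _) = primitive u x - primitive u y - k * (x - y)); last ring.
rewrite [in leRHS]distrC [in leRHS]ger0_norm ?subr_ge0//; apply: primitive_increment => // t /andP[yt tx].
by apply: ue; rewrite !ler0_norm ?subr_le0// lerN2 lerD2r.
Qed.

Lemma primitive_clamp u x : primitive u x = primitive u (clamp lo hi x).
Proof. by rewrite /primitive (clamp_id (clamp_itv _ lohi)). Qed.

Lemma primitive_lo u : primitive u lo = 0.
Proof. by rewrite /primitive clamp_le// set_itv1 Rintegral_set1. Qed.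

Lemma primitive_lip u e x y : continuous u -> (forall t, `|u t| <= e) ->
  `|primitive u x - primitive u y| <= e * `|x - y|.
Proof.
move=> uc ue; have e0 : 0 <= e := le_trans (normr_ge0 _) (ue 0).
rewrite primitive_clamp (primitive_clamp _ y).
apply: le_trans (_ : e * `|clamp lo hi x - clamp lo hi y| <= _); last first.
  by rewrite ler_wpM2l// clamp_dist.
have := @primitive_diff u 0 e (clamp lo hi y) (clamp lo hi x) uc.
rewrite mul0r subr0; apply; rewrite ?clamp_itv// => t _.
by rewrite subr0.
Qed.

Lemma primitive_bound u e x : continuous u -> (forall t, `|u t| <= e) ->
  `|primitive u x| <= (hi - lo) * e.
Proof.
move=> uc ue; have e0 : 0 <= e := le_trans (normr_ge0 _) (ue 0).
have /andP[lx xh] := clamp_itv x lohi.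
rewrite primitive_clamp -[X in `|X|]subr0 -(primitive_lo u).
apply: le_trans (primitive_lip _ _ uc ue) _.
by rewrite mulrC ler_wpM2r// ger0_norm ?subr_ge0// lerD2r.
Qed.

End Primitive.

(** * Uniform continuity and uniform derivatives *)

Section UniformCalculus.
Context {R : realType}.
Implicit Types (F G : R * R -> R) (p q : R * R) (e : R).

Definition bounded_by F e := forall p, `|F p| <= e.

Definition ucont F := forall e, 0 < e -> exists2 d, 0 < d &
  forall p q, `|p.1 - q.1| <= d -> `|p.2 - q.2| <= d -> `|F p - F q| <= e.

Definition swap p : R * R := (p.2, p.1).

Lemma ucont_swap F : ucont F -> ucont (F \o swap).
Proof.
by move=> Fu e /Fu[d d0 dP]; exists d => // p q p1 p2; exact: dP.
Qed.

Lemma ucontD F G : ucont F -> ucont G -> ucont (fun p => F p + G p).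
Proof.
move=> Fu Gu e e0; have e2 : 0 < e / 2 by rewrite divr_gt0.
have [d1 d10 d1P] := Fu _ e2; have [d2 d20 d2P] := Gu _ e2.
exists (Order.min d1 d2); first by rewrite lt_min d10.
move=> p q; rewrite !le_min => /andP[p1 p2] /andP[q1 q2].
rewrite opprD addrACA (le_trans (ler_normD _ _))//.
by have := d1P _ _ p1 q1; have := d2P _ _ p2 q2 => ? ?; lra.
Qed.

Lemma ucontN F : ucont F -> ucont (fun p => - F p).
Proof.
by move=> Fu e /Fu[d d0 dP]; exists d => // p q p1 p2; rewrite -opprD normrN; exact: dP.
Qed.

Lemma ucont_continuous F : ucont F -> continuous F.
Proof.
move=> Fu p; apply/cvgrPdist_le => e /Fu[d d0 dP].
have : \forall q \near p, ball p d q by exact: nbhsx_ballx.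
by apply: filterS => q [/ltW p1 /ltW p2]; exact: dP.
Qed.

Lemma ucont_section F y : ucont F -> continuous (fun x => F (x, y)).
Proof.
move=> Fu x; apply/cvgrPdist_le => e /Fu[d d0 dP].
have : \forall z \near x, `|x - z| < d by exact: nbhsx_ballx.
by apply: filterS => z /ltW xz; apply: dP => //=; rewrite subrr normr0 ltW.
Qed.

Definition Ix (lo hi : R) F p : R := primitive lo hi (fun t => F (t, p.2)) p.1.
Definition Iy (lo hi : R) F p : R := primitive lo hi (fun t => F (p.1, t)) p.2.

(* [F] is the derivative of [G] in the first variable, uniformly over the strip
   [lo, hi] * R; for uniformly continuous functions this notion passes through
   integration in the second variable by mere monotonicity of the integral. *)
Definition unif_derivative (lo hi : R) G F := forall e, 0 < e -> exists2 d, 0 < d &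
  forall x x' y, lo <= x <= hi -> lo <= x' <= hi -> `|x' - x| <= d ->
  `|G (x', y) - G (x, y) - F (x, y) * (x' - x)| <= e * `|x' - x|.

Section Bounds.
Variables (lo hi : R).
Hypothesis lohi : lo < hi.

Let width_gt0 : 0 < hi - lo. Proof. by rewrite subr_gt0. Qed.

Lemma Ix_bounded F e : ucont F -> bounded_by F e ->
  bounded_by (Ix lo hi F) ((hi - lo) * e).
Proof.
by move=> Fu Fe p; apply: primitive_bound => //; [exact: ltW|exact: ucont_section].
Qed.

Lemma Ix_ucont F e : bounded_by F e -> ucont F -> ucont (Ix lo hi F).
Proof.
move=> Fe Fu eps eps0.
have e0 : 0 <= e := le_trans (normr_ge0 _) (Fe (0, 0)).
have k0 : 0 < eps / 2 / (hi - lo) by rewrite !divr_gt0.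
have [d d0 dP] := Fu _ k0.
pose d' := eps / 2 / (e + 1); have e1 : 0 < e + 1 by rewrite ltr_wpDl.
have d'0 : 0 < d' by rewrite !divr_gt0.
exists (Order.min d d'); first by rewrite lt_min d0.
move=> p q; rewrite !le_min => /andP[_ p1] /andP[p2 _].
have step1 : `|Ix lo hi F p - Ix lo hi F (q.1, p.2)| <= eps / 2.
  have := primitive_lip (ltW lohi) p.1 q.1 (ucont_section (y := p.2) Fu) (fun t => Fe (t, p.2)).
  move=> /le_trans; apply; apply: (@le_trans _ _ ((e + 1) * d')); first by rewrite ler_pM// lerDl.
  by rewrite /d' mulrCA mulfV ?gt_eqF// mulr1.
have step2 : `|Ix lo hi F (q.1, p.2) - Ix lo hi F q| <= eps / 2.
  have cp := ucont_section (y := p.2) Fu; have cq := ucont_section (y := q.2) Fu.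
  have := primitive_lin lo hi 0 q.1 cp cq cp; rewrite mulr0 subr0 => <-.
  have -> : eps / 2 = (hi - lo) * (eps / 2 / (hi - lo)).
    by rewrite mulrCA mulfV ?gt_eqF// mulr1.
  apply: primitive_bound; first exact: ltW.
    move=> z; apply: cvgB; first by apply: cvgB; [exact: cp|exact: cq].
    by apply: cvgM; [exact: cp|exact: cvg_cst].
  by move=> t; rewrite mulr0 subr0; apply: dP => //=; rewrite subrr normr0 ltW.
rewrite -(subrKA (Ix lo hi F (q.1, p.2))) (le_trans (ler_normD _ _))//.
by move: step1 step2 => ? ?; lra.
Qed.

Lemma Ix_unif_derivative F : ucont F -> unif_derivative lo hi (Ix lo hi F) F.
Proof.
move=> Fu e /Fu[d d0 dP]; exists d => // x x' y xI x'I xd.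
apply: primitive_diff => //; first exact: ucont_section.
by move=> t tx; apply: dP => /=; [exact: le_trans xd|rewrite subrr normr0 ltW].
Qed.

Lemma Iy_unif_derivative lo' hi' G F : ucont G -> ucont F ->
  unif_derivative lo' hi' G F ->
  unif_derivative lo' hi' (Iy lo hi G) (Iy lo hi F).
Proof.
move=> Gu Fu GF e e0; have k0 : 0 < e / (hi - lo) by rewrite divr_gt0.
have [d d0 dP] := GF _ k0; exists d => // x x' y xI x'I xd.
have sec H x0 : ucont H -> continuous (fun t => H (x0, t)).
  by move=> Hu; exact: ucont_section (ucont_swap Hu).
have := primitive_lin lo hi (x' - x) y (sec _ x' Gu) (sec _ x Gu) (sec _ x Fu).
rewrite /Iy/= => <-.
have -> : e * `|x' - x| = (hi - lo) * (e / (hi - lo) * `|x' - x|).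
  by field; rewrite gt_eqF.
apply: primitive_bound; first exact: ltW.
  move=> z; apply: cvgB; first by apply: cvgB; exact: sec.
  by apply: cvgM; [exact: sec|exact: cvg_cst].
by move=> t; exact: dP.
Qed.

End Bounds.

Definition deriv_filter (lo hi : R) (x : R) := within `[lo, hi]%classic x^'.

Lemma deriv_filterS lo hi x d (P : set R) : 0 < d ->
  (forall t, lo <= t <= hi -> t != x -> `|t - x| < d -> P t) ->
  deriv_filter lo hi x P.
Proof.
move=> d0 dP; rewrite /deriv_filter/within/= /dnbhs/within/=.
apply/nbhs_ballP; exists d => //= t xt tx; rewrite in_itv/= => tI.
by apply: dP => //; rewrite distrC.
Qed.

(** Needed for limits along this filter to be unique, so that [lim] in [deriv_in] can be computed;
    at [hi] the points come from the left. *)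
Lemma deriv_filter_proper lo hi x : lo < hi -> lo <= x <= hi ->
  ProperFilter (deriv_filter lo hi x).
Proof.
move=> lohi /andP[lx xh]; apply: Build_ProperFilter_ex => P.
rewrite /deriv_filter/within/= /dnbhs/within/= => /nbhs_ballP[e /= e0 eP].
have [xhi|] := ltP x hi.
  pose t := x + Order.min (e / 2) (hi - x).
  have m0 : 0 < Order.min (e / 2) (hi - x) by rewrite lt_min divr_gt0//= subr_gt0.
  have m1 : Order.min (e / 2) (hi - x) <= e / 2 by rewrite ge_min lexx.
  have m2 : Order.min (e / 2) (hi - x) <= hi - x by rewrite ge_min lexx orbT.
  exists t; apply: (eP t); rewrite /t.
  - by rewrite /ball/= opprD addNKr normrN gtr0_norm//; lra.
  - by rewrite -[X in _ != X]addr0 (inj_eq (addrI _)) gt_eqF.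
  - by rewrite /= in_itv/=; lra.
move=> hx; pose t := x - Order.min (e / 2) (x - lo).
have m0 : 0 < Order.min (e / 2) (x - lo) by rewrite lt_min divr_gt0//=; lra.
have m1 : Order.min (e / 2) (x - lo) <= e / 2 by rewrite ge_min lexx.
have m2 : Order.min (e / 2) (x - lo) <= x - lo by rewrite ge_min lexx orbT.
exists t; apply: (eP t); rewrite /t.
- by rewrite /ball/= subKr gtr0_norm//; lra.
- by rewrite -[X in _ != X]addr0 (inj_eq (addrI _)) oppr_eq0 gt_eqF.
- by rewrite /= in_itv/=; lra.
Qed.

Lemma unif_derivative_cvg lo hi G F x y : unif_derivative lo hi G F ->
  lo <= x <= hi ->
  diffquot (fun t => G (t, y)) x t @[t --> deriv_filter lo hi x] --> F (x, y).
Proof.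
move=> GF xI; apply/cvgrPdist_le => e /GF[d d0 dP].
apply: (deriv_filterS d0) => t tI tx /ltW td.
rewrite /diffquot/= distrC.
have tx0 : t - x != 0 by rewrite subr_eq0.
have -> : (G (t, y) - G (x, y)) / (t - x) - F (x, y) =
    (G (t, y) - G (x, y) - F (x, y) * (t - x)) / (t - x) by field.
by rewrite normf_div ler_pdivrMr ?normr_gt0//; exact: dP.
Qed.

(** Equality is asked on [lo, hi] only, because the iterated derivatives of the corrected function
    are known only on the rectangle. *)
Lemma deriv_in_add lo hi (u1 u2 v : R -> R) x l : lo < hi -> lo <= x <= hi ->
  (forall t, lo <= t <= hi -> u1 t = u2 t + v t) ->
  derivable_in `[lo, hi]%classic u2 x ->
  diffquot v x t @[t --> deriv_filter lo hi x] --> l ->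
  derivable_in `[lo, hi]%classic u1 x /\
  deriv_in `[lo, hi]%classic u1 x = deriv_in `[lo, hi]%classic u2 x + l.
Proof.
move=> lohi xI uE du2 vl; have PF := deriv_filter_proper lohi xI.
have h : diffquot u1 x t @[t --> deriv_filter lo hi x] -->
    deriv_in `[lo, hi]%classic u2 x + l.
  apply: cvg_trans (cvgD du2 vl); apply: near_eq_cvg.
  apply: (@deriv_filterS lo hi x 1) => // t tI _ _.
  rewrite -[LHS]/(diffquot u2 x t + diffquot v x t) /diffquot !uE// -mulrDl.
  by congr (_ / _); ring.
split; first by apply/cvg_ex; exists (deriv_in `[lo, hi]%classic u2 x + l).
exact: (cvg_lim _ h).
Qed.

End UniformCalculus.

(** * Partial derivatives of iterated integrals *)

Section IteratedIntegrals.
Context {R : realType}.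
Variables (a b c d : R).
Hypotheses (ab : a < b) (cd : c < d).
Implicit Types (F psi f : R * R -> R) (p q : R * R).
Local Notation rect := (rect a b c d).
Local Notation D := (D a b c d).

Definition Ixy i j psi := iter j (Iy c d) (iter i (Ix a b) psi).

Lemma IyE F : Iy c d F = Ix c d (F \o swap) \o swap.
Proof. by []. Qed.

Lemma Ixy_ucont i j psi e : ucont psi -> bounded_by psi e ->
  ucont (Ixy i j psi) /\ bounded_by (Ixy i j psi) ((b - a) ^+ i * (d - c) ^+ j * e).
Proof.
move=> psiu psie; rewrite /Ixy; elim: j => [|j [IHu IHb]] /=.
  rewrite mulr1; elim: i => [|i [IHu IHb]] /=; first by rewrite mul1r.
  split; first exact: Ix_ucont IHb IHu.
  by rewrite exprS -mulrA; exact: Ix_bounded.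
have swu := ucont_swap IHu; have swb := fun p => IHb (swap p).
split; first by rewrite IyE; apply: ucont_swap; exact: Ix_ucont swb swu.
rewrite IyE => p; have := Ix_bounded cd swu swb (swap p).
by rewrite exprS -!mulrA mulrCA.
Qed.

(** The x-integrals are innermost: the derivative is taken there and carried through the y-integrals
    one at a time. *)
Lemma Ixy_derivative_x i j psi e : ucont psi -> bounded_by psi e ->
  unif_derivative a b (Ixy i.+1 j psi) (Ixy i j psi).
Proof.
move=> psiu psie; elim: j => [|j IH].
  by apply: Ix_unif_derivative => //; case: (Ixy_ucont i 0 psiu psie).
apply: Iy_unif_derivative => //.
  by case: (Ixy_ucont i.+1 j psiu psie).
by case: (Ixy_ucont i j psiu psie).
Qed.

Lemma Ixy_derivative_y i j psi e : ucont psi -> bounded_by psi e ->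
  unif_derivative c d (Ixy i j.+1 psi \o swap) (Ixy i j psi \o swap).
Proof.
move=> psiu psie; have -> : Ixy i j.+1 psi \o swap = Ix c d (Ixy i j psi \o swap).
  by apply/funext => -[y x].
by apply: Ix_unif_derivative => //; apply: ucont_swap; case: (Ixy_ucont i j psiu psie).
Qed.

Lemma rectE p : rect p -> a <= p.1 <= b /\ c <= p.2 <= d.
Proof. by case; rewrite /= !in_itv. Qed.

Lemma rectI x y : a <= x <= b -> c <= y <= d -> rect (x, y).
Proof. by move=> ? ?; split; rewrite /= in_itv. Qed.

Lemma Dx_add F1 F2 V W p : unif_derivative a b V W -> rect p ->
  (forall q, rect q -> F1 q = F2 q + V q) -> x_derivable a b F2 p ->
  x_derivable a b F1 p /\ Dx a b F1 p = Dx a b F2 p + W p.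
Proof.
case: p => x y VW /rectE[/= xI yI] FE dF2.
apply: (deriv_in_add ab xI (u1 := fun t => F1 (t, y)) (v := fun t => V (t, y)) _ dF2).
  by move=> t tI; apply: FE; exact: rectI.
exact: unif_derivative_cvg.
Qed.

Lemma Dy_add F1 F2 V W p : unif_derivative c d (V \o swap) (W \o swap) -> rect p ->
  (forall q, rect q -> F1 q = F2 q + V q) -> y_derivable c d F2 p ->
  y_derivable c d F1 p /\ Dy c d F1 p = Dy c d F2 p + W p.
Proof.
case: p => x y VW /rectE[/= xI yI] FE dF2.
apply: (deriv_in_add cd yI (u1 := fun t => F1 (x, t)) (v := fun t => V (x, t)) _ dF2).
  by move=> t tI; apply: FE; exact: rectI.
exact: (@unif_derivative_cvg _ c d (V \o swap) (W \o swap) y x VW yI).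
Qed.

Section Correction.
Variables (m n : nat) (f psi : R * R -> R) (e : R).
Hypotheses (fC : Cmn a b c d m n f) (psiu : ucont psi) (psie : bounded_by psi e).
Let g p := f p + Ixy m n psi p.

(** [D] takes the y-derivatives first, each removing the outermost y-integral; in [Dg_x] the
    x-derivatives then act under the n - l y-integrals that remain. *)
Let Dg_y l : (l <= n)%N -> (forall j p, (j < l)%N -> rect p -> y_derivable c d (D 0 j g) p) /\
  forall p, rect p -> D 0 l g p = D 0 l f p + Ixy m (n - l) psi p.
Proof.
elim: l => [|l IH] ln; first by split=> // p _; rewrite subn0.
have [IHd IHe] := IH (ltnW ln).
have step p : rect p -> y_derivable c d (D 0 l g) p /\
    D 0 l.+1 g p = D 0 l.+1 f p + Ixy m (n - l.+1) psi p.
  move=> Rp; apply: Dy_add => //; last by have [[h _] _] := fC (leq0n m) (leqnn n); exact: h.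
    by apply: (Ixy_derivative_y _ _ psiu psie).
  by move=> q Rq; rewrite -subSn// subSS; exact: IHe.
split=> [j p|p Rp]; last by case: (step p Rp).
rewrite ltnS leq_eqVlt => /orP[/eqP->|jl] Rp; first by case: (step p Rp).
exact: IHd.
Qed.

Let Dg_x k l : (k <= m)%N -> (l <= n)%N ->
  (forall i p, (i < k)%N -> rect p -> x_derivable a b (D i l g) p) /\
  forall p, rect p -> D k l g p = D k l f p + Ixy (m - k) (n - l) psi p.
Proof.
move=> + ln; elim: k => [|k IH] km.
  by split=> // p Rp; rewrite subn0; exact: (Dg_y ln).2.
have [IHd IHe] := IH (ltnW km).
have step p : rect p -> x_derivable a b (D k l g) p /\
    D k.+1 l g p = D k.+1 l f p + Ixy (m - k.+1) (n - l) psi p.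
  move=> Rp; apply: Dx_add => //; last by have [[_ h] _] := fC (leqnn m) ln; exact: h.
    by apply: (Ixy_derivative_x _ _ psiu psie).
  by move=> q Rq; rewrite -subSn// subSS; exact: IHe.
split=> [i p|p Rp]; last by case: (step p Rp).
rewrite ltnS leq_eqVlt => /orP[/eqP->|ik] Rp; first by case: (step p Rp).
exact: IHd.
Qed.

Lemma correction_D p : rect p -> D m n g p = D m n f p + psi p.
Proof. by move=> Rp; rewrite (Dg_x (leqnn m) (leqnn n)).2// !subnn. Qed.

Lemma correction_Cmn : Cmn a b c d m n g.
Proof.
move=> k l km ln; split.
  by split; [exact: (Dg_y ln).1|exact: (Dg_x km ln).1].
apply/subspace_continuousP => p Rp.
have [_ /subspace_continuousP/(_ p Rp) fc] := fC km ln.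
have ec : {for p, continuous (Ixy (m - k) (n - l) psi)}.
  by apply: ucont_continuous; case: (Ixy_ucont (m - k) (n - l) psiu psie).
have h : (fun q => D k l f q + Ixy (m - k) (n - l) psi q) @ within rect (nbhs p) -->
    D k l f p + Ixy (m - k) (n - l) psi p.
  by apply: cvgD => //; apply: cvg_within_filter; exact: ec.
suff : D k l g q @[q --> within rect (nbhs p)] --> D k l g p by [].
have -> := (Dg_x km ln).2 p Rp.
apply: cvg_trans h; apply: near_eq_cvg.
by apply: filterS (near_withinT _ _) => q Rq; rewrite (Dg_x km ln).2.
Qed.

End Correction.
End IteratedIntegrals.

(** * Extension to the plane and Lipschitz approximation *)

Section Approximation.
Context {R : realType}.
Implicit Types (F : R * R -> R) (p q : R * R).

Definition clamp2 (a b c d : R) p := (clamp a b p.1, clamp c d p.2).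

Lemma rect_clamp2 (a b c d : R) p : a <= b -> c <= d -> rect a b c d (clamp2 a b c d p).
Proof. by move=> ab cd; apply: rectI; exact: clamp_itv. Qed.

Lemma clamp2_id (a b c d : R) p : rect a b c d p -> clamp2 a b c d p = p.
Proof. by case: p => x y /rectE[/= xI yI]; rewrite /clamp2/= !clamp_id. Qed.

Lemma compact_rect (a b c d : R) : compact (rect a b c d).
Proof. by apply: compact_setX; exact: segment_compact. Qed.

(** Heine-Cantor on the compact rectangle; clamping does not increase coordinate distances and
    carries the estimate to the whole plane. *)
Lemma within_ucont (a b c d : R) F : a <= b -> c <= d ->
  {within rect a b c d, continuous F} -> ucont (F \o clamp2 a b c d).
Proof.
move=> ab cd /subspace_continuousP Fc e e0.
pose P (r : R) p := forall q, rect a b c d q -> `|p.1 - q.1| <= r -> `|p.2 - q.2| <= r ->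
  `|F p - F q| <= e.
have e2 : 0 < e / 2 by rewrite divr_gt0.
have [r r0 rP] : exists2 r, 0 < r & forall p, rect a b c d p -> P r p.
  have : \forall r \near (0 : R)^'+, rect a b c d `<=` P r.
    have := (near_covering_withinP _).2 ((compact_near_coveringP _).1 (@compact_rect a b c d)).
    apply=> p Rp; have /cvgrPdist_le/(_ _ e2) := Fc p Rp.
    rewrite /within/= => /nbhs_ballP[s /= s0 sP].
    have s2 : 0 < s / 2 by rewrite divr_gt0.
    exists (ball p (s / 2), [set r | 0 < r < s / 2]) => /=.
      split; first exact: nbhsx_ballx.
      by near=> r; apply/andP; split; near: r; [exact: nbhs_right_gt|exact: nbhs_right_lt].
    move=> [p' r] /= [[p1 p2] /andP[r0 rs]] Rp' q Rq q1 q2.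
    have h1 : `|F p - F p'| <= e / 2.
      by apply: sP => //; split; apply: lt_le_trans; [exact: p1| |exact: p2|]; lra.
    have h2 : `|F p - F q| <= e / 2.
      apply: sP => //; split; rewrite /ball/=.
        rewrite -(subrKA p'.1) (le_lt_trans (ler_normD _ _))//; move: p1; rewrite /ball/=; lra.
      rewrite -(subrKA p'.2) (le_lt_trans (ler_normD _ _))//; move: p2; rewrite /ball/=; lra.
    by rewrite ler_distlC in h1; rewrite ler_distlC in h2; rewrite ler_distlC; lra.
  move=> nearP; near (0 : R)^'+ => r; exists r; first by [].
  by have : rect a b c d `<=` P r by near: r.
exists r => // p q p1 p2; apply: rP; try exact: rect_clamp2.
  exact: le_trans (clamp_dist _ _ _ _) p1.
exact: le_trans (clamp_dist _ _ _ _) p2.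
Unshelve. all: by end_near. Qed.

Lemma within_bounded (a b c d : R) F : {within rect a b c d, continuous F} ->
  exists M, forall p, rect a b c d p -> `|F p| <= M.
Proof.
move=> Fc; have /compact_bounded[M [_ MP]] := continuous_compact Fc (@compact_rect a b c d).
exists (M + 1) => p Rp; apply: (MP (M + 1)); first by rewrite ltrDl.
by exists p.
Qed.

(* The infimal convolution of F with the cone L * |p - q|. *)
Lemma lipschitz_approx F M k : ucont F -> (forall p, 0 <= F p <= M) -> 0 < k ->
  exists P : R * R -> R, exists L, [/\ 0 <= L, forall p, 0 <= P p <= F p,
    forall p, F p - k <= P p &
    forall p q, `|P p - P q| <= L * (`|p.1 - q.1| + `|p.2 - q.2|)].
Proof.
move=> Fu FM k0; have [r r0 rP] := Fu _ k0.
have M0 : 0 <= M by have /andP[h1 h2] := FM (0, 0); exact: le_trans h2.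
(* With slope M / r the cone reaches [M] at distance [r], so points farther away cannot push the
   infimum below F p; nearer ones satisfy F q >= F p - k. *)
pose L := M / r; have L0 : 0 <= L by rewrite divr_ge0// ltW.
pose S p := [set F q + L * (`|p.1 - q.1| + `|p.2 - q.2|) | q in [set: R * R]].
have dist0 p q : 0 <= L * (`|p.1 - q.1| + `|p.2 - q.2|) by rewrite mulr_ge0// addr_ge0.
have S0 p : lbound (S p) 0.
  by move=> _ [q _ <-]; rewrite addr_ge0//; case/andP: (FM q).
have Sne p : S p !=set0 by exists (F p + L * (`|p.1 - p.1| + `|p.2 - p.2|)); exists p.
have Sinf p : has_inf (S p) by split; [exact: Sne|exists 0; exact: S0].
pose P p := inf (S p).
have Ple p q : P p <= F q + L * (`|p.1 - q.1| + `|p.2 - q.2|).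
  by apply: ge_inf; [exists 0; exact: S0|exists q].
have Pge p z : lbound (S p) z -> z <= P p by move=> zS; exact: lb_le_inf.
exists P, L; split=> //.
- move=> p; rewrite Pge//=; have := Ple p p.
  by rewrite !subrr normr0 addr0 mulr0 addr0.
- move=> p; apply: Pge => _ [q _ <-]; have /andP[q0 qM] := FM q; have /andP[p0 pM] := FM p.
  have [q1|q1] := leP `|p.1 - q.1| r; last first.
    have : L * r <= L * (`|p.1 - q.1| + `|p.2 - q.2|).
      by rewrite ler_wpM2l// (le_trans (ltW q1))// lerDl.
    by rewrite /L divfK ?gt_eqF// -/L => h; lra.
  have [q2|q2] := leP `|p.2 - q.2| r; last first.
    have : L * r <= L * (`|p.1 - q.1| + `|p.2 - q.2|).
      by rewrite ler_wpM2l// (le_trans (ltW q2))// lerDr.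
    by rewrite /L divfK ?gt_eqF// -/L => h; lra.
  have := rP _ _ q1 q2; have := dist0 p q; rewrite ler_distlC => h1 h2; lra.
- have half p q : P p <= P q + L * (`|p.1 - q.1| + `|p.2 - q.2|).
    rewrite -lerBlDr; apply: Pge => _ [z _ <-]; rewrite lerBlDr.
    apply: le_trans (Ple p z) _; rewrite -addrA lerD2l -mulrDr ler_wpM2l//.
    have h1 := ler_distD q.1 p.1 z.1; have h2 := ler_distD q.2 p.2 z.2; lra.
  move=> p q; have h1 := half p q; have h2 := half q p.
  by rewrite ler_distlC [`|p.1 - _|]distrC [`|p.2 - _|]distrC in h1 h2 *; lra.
Qed.

End Approximation.

Lemma lipschitz_ucont (R : realType) (F : R * R -> R) (L : R) : 0 <= L ->
  (forall p q, `|F p - F q| <= L * (`|p.1 - q.1| + `|p.2 - q.2|)) -> ucont F.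
Proof.
move=> L0 FL e e0; have L1 : 0 < 2 * (L + 1) by rewrite mulr_gt0// ltr_wpDl.
exists (e / (2 * (L + 1))) => [|p q p1 p2]; first by rewrite divr_gt0.
apply: le_trans (FL p q) _.
apply: (@le_trans _ _ ((L + 1) * (e / (2 * (L + 1)) + e / (2 * (L + 1))))).
  by rewrite ler_pM ?addr_ge0 ?lerD// lerDl.
by rewrite le_eqVlt; apply/orP; left; apply/eqP; field; rewrite gt_eqF// ltr_wpDl.
Qed.

(** * The rough perturbation on the rectangle *)

Section RoughTerm.
Context {R : realType}.
Variables (a b c d theta k : R).
Hypotheses (ab : a < b) (cd : c < d) (theta01 : 0 <= theta <= 1) (k_gt0 : 0 < k).

(** The shift by 1 makes the term nonnegative, since [rough] takes values in [-1, 2]. *)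
Definition rough_term (p : R * R) : R :=
  k * (rough (stack theta) ((p.1 - a) / (b - a)) + 1).

Lemma rough_term_bounds p : 0 <= rough_term p <= 3 * k.
Proof.
have /andP[w1 w2] := rough_bounds (stack theta) ((p.1 - a) / (b - a)).
by rewrite /rough_term; apply/andP; split; [rewrite mulr_ge0// ?(ltW k_gt0)//; lra|rewrite mulrC ler_pM2r//; lra].
Qed.

Lemma rough_term_ucont : ucont rough_term.
Proof.
have ba : 0 < b - a by rewrite subr_gt0.
move=> e e0; have ek : 0 < e / k by rewrite divr_gt0.
have [r r0 rP] := rough_uniformly_continuous (height_stack_unbounded theta) ek.
exists (r * (b - a)) => [|p q p1 _]; first by rewrite mulr_gt0.
rewrite /rough_term -mulrBr opprD addrACA subrr addr0 normrM (gtr0_norm k_gt0) mulrC -ler_pdivlMr//.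
apply: rP; rewrite -mulrBl opprB addrA subrK normrM [`|_^-1|]gtr0_norm ?invr_gt0//.
by rewrite ler_pdivrMr.
Qed.

Lemma graph_rough_has_dim dim (P h : R * R -> R) L : 0 <= L ->
  (forall p q, `|P p - P q| <= L * (`|p.1 - q.1| + `|p.2 - q.2|)) ->
  (forall p, rect a b c d p -> h p = P p + rough_term p) ->
  has_dim dim (graph a b c d h) (3 - theta).
Proof.
move=> L0 PL hE; have ba : 0 < b - a by rewrite subr_gt0.
have dc : 0 < d - c by rewrite subr_gt0.
pose param (q : R * R) := (a + (b - a) * q.1, c + (d - c) * q.2).
pose w : R -> R := rough (stack theta).
pose H q := P (param q) + k * (w q.1 + 1).
have inv q : ((param q).1 - a) / (b - a) = q.1.
  by rewrite /param/= addrC addKr mulrAC mulfV ?mul1r// gt_eqF.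
have HE q : H q = P (param q) + rough_term (param q) by rewrite /rough_term inv.
have -> : graph a b c d h = (fun q => \row_(i < 3) [:: (param q).1; (param q).2; H q]`_i) @`
    (`[0, 1]%classic `*` `[0, 1]%classic).
  apply/seteqP; split=> _ [p pI <-].
    have /rectE[xI yI] := pI.
    exists ((p.1 - a) / (b - a), (p.2 - c) / (d - c)).
      split; rewrite /= in_itv/=.
        by rewrite ler_pdivlMr// ler_pdivrMr//; lra.
      by rewrite ler_pdivlMr// ler_pdivrMr//; lra.
    have pE : param ((p.1 - a) / (b - a), (p.2 - c) / (d - c)) = p.
      by case: p {pI xI yI} => x y; rewrite /param/=; congr pair; field; rewrite gt_eqF.
    by rewrite HE pE -hE.
  have Rp : rect a b c d (param p).
    case: pI => /=; rewrite !in_itv/= => /andP[x0 x1] /andP[y0 y1].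
    apply: rectI; nra.
  by exists (param p); rewrite // HE -hE.
(* The first three summands give the upper comparison of [H] with [w]. The quotient gives the lower
   one, where [k] times the increment of [w] is at most the increments of [H] and [P] together. *)
pose K1 := L * (b - a) + L * (d - c) + k + (1 + L * (b - a) + L * (d - c)) / k.
have La : 0 <= L * (b - a) by rewrite mulr_ge0// ltW.
have Lc : 0 <= L * (d - c) by rewrite mulr_ge0// ltW.
have I0 : 0 <= (1 + L * (b - a) + L * (d - c)) / k by rewrite divr_ge0 ?(ltW k_gt0)//; lra.
have K10 : 0 <= K1 by rewrite /K1; have := k_gt0; lra.
have PH q q' : `|P (param q) - P (param q')| <=
    L * (b - a) * `|q.1 - q'.1| + L * (d - c) * `|q.2 - q'.2|.
  apply: le_trans (PL _ _) _; rewrite /param/= mulrDr.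
  rewrite (_ : a + _ - _ = (b - a) * (q.1 - q'.1)); last ring.
  rewrite (_ : c + _ - _ = (d - c) * (q.2 - q'.2)); last ring.
  by rewrite !normrM (gtr0_norm ba) (gtr0_norm dc) !mulrA.
apply: (@rough_graph_has_dim R a b c d theta K1 H) => //.
- move=> q q' _ _.
  have -> : H q - H q' = (P (param q) - P (param q')) + k * (w q.1 - w q'.1).
    by rewrite /H; ring.
  apply: le_trans (ler_normD _ _) _; rewrite normrM (gtr0_norm k_gt0).
  have k0 := k_gt0; have hP := PH q q'.
  have e1 : L * (b - a) * `|q.1 - q'.1| <= K1 * `|q.1 - q'.1|.
    by rewrite ler_wpM2r// /K1; lra.
  have e2 : L * (d - c) * `|q.2 - q'.2| <= K1 * `|q.2 - q'.2|.
    by rewrite ler_wpM2r// /K1; lra.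
  have e3 : k * `|w q.1 - w q'.1| <= K1 * `|w q.1 - w q'.1|.
    by rewrite ler_wpM2r// /K1; lra.
  by rewrite !mulrDr; lra.
- move=> q q' _ _; rewrite -/w -(ler_pM2l k_gt0).
  have k0 := k_gt0; have hP := PH q q'.
  have kw : k * `|w q.1 - w q'.1| <= `|H q - H q'| + `|P (param q) - P (param q')|.
    rewrite -{1}(gtr0_norm k_gt0) -normrM.
    have -> : k * (w q.1 - w q'.1) = (H q - H q') - (P (param q) - P (param q')).
      by rewrite /H; ring.
    exact: ler_normB.
  have kK : 1 + L * (b - a) + L * (d - c) <= k * K1.
    have -> : k * K1 = k * (L * (b - a) + L * (d - c) + k) + (1 + L * (b - a) + L * (d - c)).
      by rewrite /K1; field; rewrite gt_eqF.
    by rewrite lerDr mulr_ge0//; lra.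
  set S := _ + _ + _; have S0 : 0 <= S by rewrite !addr_ge0.
  rewrite mulrA; apply: le_trans (_ : (1 + L * (b - a) + L * (d - c)) * S <= _); last first.
    by rewrite ler_wpM2r.
  have s1 : `|q.1 - q'.1| <= S by rewrite /S -addrA lerDl addr_ge0.
  have s2 : `|q.2 - q'.2| <= S by rewrite /S addrAC lerDr addr_ge0.
  have s3 : `|H q - H q'| <= S by rewrite /S lerDr addr_ge0.
  have e1 : L * (b - a) * `|q.1 - q'.1| <= L * (b - a) * S by rewrite ler_wpM2l.
  have e2 : L * (d - c) * `|q.2 - q'.2| <= L * (d - c) * S by rewrite ler_wpM2l.
  by rewrite !mulrDl mul1r; lra.
Qed.

End RoughTerm.

Theorem theorem2p8 (R : realType) (dim : dimension_kind) (a b c d : R)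
    (m n : nat) (beta : R) (f : R * R -> R) :
  a < b -> c < d -> 2 <= beta <= 3 ->
  mn_convex a b c d m n f ->
  (forall y, c <= y <= d -> f (a, y) = 0) ->
  (forall x, a <= x <= b -> f (x, c) = 0) ->
  forall eps : R, 0 < eps ->
  exists g : R * R -> R,
    [/\ mn_convex a b c d m n g,
        S_beta dim a b c d beta (D a b c d m n g) &
        (supnorm a b c d (fun p => (f p - g p)%R) < eps%:E)%E].
Proof.
move=> ab cd beta23 [fC fpos] _ _ eps eps0.
have [_ phic] := fC m n (leqnn m) (leqnn n).
pose phi := D a b c d m n f \o clamp2 a b c d.
have phiu : ucont phi := within_ucont (ltW ab) (ltW cd) phic.
have [M MP] := within_bounded phic.
have phiM p : 0 <= phi p <= M.
  have Rp := rect_clamp2 p (ltW ab) (ltW cd).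
  by rewrite /phi/= fpos// (le_trans (ler_norm _))// MP.
have ba : 0 < b - a by rewrite subr_gt0.
have dc : 0 < d - c by rewrite subr_gt0.
pose vol := (b - a) ^+ m * (d - c) ^+ n.
have vol0 : 0 < vol by rewrite mulr_gt0// exprn_gt0.
(* |psi| <= 3 * k below, and the iterated integrals multiply bounds by [vol]; the total error is
   thus at most eps / 2. *)
pose k := eps / (6 * vol); have k0 : 0 < k by rewrite divr_gt0// mulr_gt0.
have [P [L [L0 P0 Pk PL]]] := lipschitz_approx phiu phiM k0.
pose theta := 3 - beta; have theta01 : 0 <= theta <= 1 by rewrite /theta; lra.
pose rt := rough_term a b theta k.
have rtb p : 0 <= rt p <= 3 * k by exact: rough_term_bounds.
pose psi p := P p + rt p - phi p.
have psiu : ucont psi.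
  apply: ucontD; last exact: ucontN.
  by apply: ucontD; [exact: lipschitz_ucont PL|exact: rough_term_ucont].
(* P - phi lies in [-k, 0] and the rough term in [0, 3 * k]. *)
have psib : bounded_by psi (3 * k).
  move=> p; have := rtb p; have := P0 p; have := Pk p => h1 h2 h3.
  by rewrite ler_norml /psi; lra.
pose g p := f p + Ixy a b c d m n psi p.
have gC : Cmn a b c d m n g := correction_Cmn ab cd fC psiu psib.
have Dg p : rect a b c d p -> D a b c d m n g p = P p + rt p.
  move=> Rp; rewrite (correction_D ab cd fC psiu psib Rp) /psi /phi/= clamp2_id//.
  by rewrite addrC subrK.
exists g; split.
- split=> // p Rp; rewrite Dg// addr_ge0//; first by case/andP: (P0 p).
  by case/andP: (rtb p).
- split; first by case: (gC m n (leqnn m) (leqnn n)).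
  have -> : beta = 3 - theta by rewrite /theta opprB addrC subrK.
  exact: graph_rough_has_dim PL Dg.
- apply: (@le_lt_trans _ _ (vol * (3 * k))%:E); last first.
    rewrite lte_fin (_ : vol * (3 * k) = eps / 2); last by rewrite /k; field; rewrite gt_eqF.
    by lra.
  apply: ge_ereal_sup => _ [p Rp <-]; rewrite lee_fin /g opprD addrA subrr sub0r normrN.
  by have [_] := Ixy_ucont ab cd m n psiu psib; exact.
Qed.
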